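(* Assume there is an oracle $\mathcal{O}$ which, given any nonsingular $B'\in\mathbb{Z}^{n\times n}$, returns $\lambda_1(L(B'))$ (optimization SVP). Then there is an algorithm which, given any nonsingular $B\in\mathbb{Z}^{n\times n}$, outputs a vector $v\in L(B)$ with $\|v\|=\lambda_1(L(B))$ (search SVP), making exactly one call to $\mathcal{O}$ (on a nonsingular integer $n\times n$ matrix), and running in time polynomial in $\log_2 M$, $n$ and $\log_2 n$, where $M=\max_{i,j}|b_{ij}|$ is the largest absolute value of an entry of $B$.
   Context: For a nonsingular $B\in\mathbb{R}^{n\times n}$ with columns $b_1,\dots,b_n$, the lattice is $L(B)=\{\sum_{i=1}^n x_ib_i : x_i\in\mathbb{Z}\}$ and $\lambda_1(L(B))$ is the Euclidean length of a shortest nonzero vector of $L(B)$. Oracle calls are counted as unit cost. *)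

(* Defs.v *)
From mathcomp Require Import all_boot all_order all_algebra.
From mathcomp Require Import classical_sets reals.
From mathcomp Require Import Rstruct.
Set Implicit Arguments. Unset Strict Implicit. Unset Printing Implicit Defensive.
Import Order.TTheory GRing.Theory Num.Theory.
Local Open Scope ring_scope.
Local Open Scope classical_set_scope.

Section Lattice.
Variable R : realType.

Definition lattice (n : nat) (B : 'M[R]_n) : set 'cV[R]_n :=
  [set v | exists x : 'cV[int]_n, v = B *m map_mx (fun z : int => z%:~R) x].

Definition vnorm (n : nat) (v : 'cV[R]_n) : R := Num.sqrt (\sum_i v i 0 ^+ 2).

Definition lambda1 (n : nat) (B : 'M[R]_n) : R :=
  inf [set vnorm v | v in [set v | lattice B v /\ v != 0]].
End Lattice.

Definition mxR (m n : nat) (A : 'M[int]_(m, n)) : 'M[Rdefinitions.R]_(m, n) :=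
  map_mx (fun z : int => z%:~R) A.

(* Model of computation: a random access machine with integer         *)
(* registers (memory nat -> int), logarithmic cost (Cook-Reckhow),    *)
(* indirect addressing, and an oracle instruction of unit cost.        *)
Inductive instr :=
| IConst of nat & int
| IAdd of nat & nat & nat
| ISub of nat & nat & nat
| IMul of nat & nat & nat
| IDiv of nat & nat & nat        (* mem[d] := mem[a] %/ mem[b] (floor; /0=0) *)
| ILoad of nat & nat
| IStore of nat & nat
| IJlt of nat & nat & nat
| IJmp of nat
| IOracle of nat & nat
| IHalt.

Definition program := seq instr.

Definition oracle := forall m : nat, 'M[int]_m -> int.

Definition query := {m : nat & 'M[int]_m}.

Record state := State { pc : nat; memory : nat -> int; cost : nat; queries : seq query }.

Definition bl (z : int) : nat := (trunc_log 2 `|z|%N).+1.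
Definition bln (a : nat) : nat := (trunc_log 2 a).+1.

Definition upd (f : nat -> int) (d : nat) (z : int) : nat -> int :=
  fun x => if x == d then z else f x.

Definition query_mx (f : nat -> int) (a : nat) : query :=
  let m := `|f a|%N in
  existT (fun m => 'M[int]_m) m (\matrix_(i < m, j < m) f (a + 1 + i * m + j)%N).

Definition arith (op : int -> int -> int) (st : state) d a b : state :=
  let f := memory st in
  State (pc st).+1 (upd f d (op (f a) (f b)))
        (cost st + (1 + bln d + bln a + bln b + bl (f a) + bl (f b)))%N
        (queries st).

Definition step (O : oracle) (P : program) (st : state) : option state :=
  let f := memory st in
  match nth IHalt P (pc st) with
  | IConst d c => Some (State (pc st).+1 (upd f d c)
                          (cost st + (1 + bln d + bl c))%N (queries st))
  | IAdd d a b => Some (arith +%R st d a b)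
  | ISub d a b => Some (arith (fun x y => x - y) st d a b)
  | IMul d a b => Some (arith *%R st d a b)
  | IDiv d a b => Some (arith (fun x y => (x %/ y)%Z) st d a b)
  | ILoad d a => Some (State (pc st).+1 (upd f d (f `|f a|%N))
                  (cost st + (1 + bln d + bln a + bl (f a) + bl (f `|f a|%N)))%N
                  (queries st))
  | IStore a s => Some (State (pc st).+1 (upd f `|f a|%N (f s))
                  (cost st + (1 + bln a + bln s + bl (f a) + bl (f s)))%N
                  (queries st))
  | IJlt a b l => Some (State (if f a < f b then l else (pc st).+1) f
                  (cost st + (1 + bln a + bln b + bl (f a) + bl (f b)))%N
                  (queries st))
  | IJmp l => Some (State l f (cost st).+1 (queries st))
  | IOracle d a =>
      let q := query_mx f a in
      Some (State (pc st).+1 (upd f d (O (projT1 q) (projT2 q)))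
                  (cost st).+1 (rcons (queries st) q))
  | IHalt => None
  end.

Fixpoint run (O : oracle) (P : program) (fuel : nat) (st : state) : option state :=
  match fuel with
  | 0 => None
  | fuel'.+1 => match step O P st with
                | None => Some st
                | Some st' => run O P fuel' st'
                end
  end.

(* input convention: mem[0] = n, mem[1 + i*n + j] = B i j, all else 0 *)
Definition init_mem (n : nat) (B : 'M[int]_n) : nat -> int :=
  fun x => if x == 0%N then n%:Z
           else let y := x.-1 in
             if (y < n * n)%N then
               (if (y %/ n < n)%N =P true is ReflectT hi then
                  (if (y %% n < n)%N =P true is ReflectT hj then
                     B (Ordinal hi) (Ordinal hj) else 0)
                else 0)
             else 0.

Definition init_state (n : nat) (B : 'M[int]_n) : state :=
  State 0 (init_mem B) 0 [::].

Definition output (n : nat) (f : nat -> int) : 'cV[int]_n :=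
  \col_(j < n) f (1 + j)%N.

(* optimization-SVP oracle: on nonsingular B' returns lambda_1(L(B'))
   (encoded as the integer lambda_1^2, since registers hold integers) *)
Definition svp_oracle (O : oracle) : Prop :=
  forall (m : nat) (B' : 'M[int]_m), \det B' != 0 ->
    (O m B')%:~R = lambda1 (mxR B') ^+ 2.

Definition maxentry (n : nat) (B : 'M[int]_n) : nat :=
  (\max_(i < n) \max_(j < n) `|B i j|%N)%N.

(* Main.v *)
Require Import Defs.
From mathcomp Require Import all_boot all_order all_algebra.
From mathcomp Require Import classical_sets reals Rstruct.
From mathcomp Require Import boolp zify ring lra.
Import Order.TTheory GRing.Theory Num.Theory.
Local Open Scope ring_scope.

(** Let S bound n and the squared norm of all entries of B, and put T = S^(n+1),
    K = 4T, P = K^(n+1), N = P^2.  The oracle is called on the matrix B' obtained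
    from N B by adding K^j to the entry (0, j).  With v = B y and
    s = sum_j K^j y_j,
      |B' y|^2 = N^2 |v|^2 + 2 N v_0 s + s^2.
    Cramer's rule bounds |y_j| by S^n |v|_1, so that N is large enough for the
    last two terms to be negligible: a shortest vector B' y of the perturbed
    lattice yields a shortest vector B y of the original one.  For this y one
    has |s| < P, hence s^2 < N and lambda_1(B')^2 mod 2N = s^2 as N is even.
    Finally |y_j| <= T < K/2, so the balanced digits of |s| in base K are y, up
    to a global sign. *)

(** * Hoare triples for the random access machine *)

Section Framework.
Local Open Scope nat_scope.

(** One call returns one number, so a single query has to carry all coordinates. Disturbing one row
    only makes the disturbance depend on [y] through one linear form [s], and the powers of [K] make
    [s] injective on small vectors. The obstacle is that a shortest vector of B' competes with every
    [y], however long. The disturbance is therefore bounded relative to |B y|^2, with factor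
    [D = 2 n K^n S^n]. Squared lengths are integers, so a vector that is not shortest for B exceeds
    the minimum, itself at most [S], by at least 1; [D (1 + 3 S) < N] keeps such a vector from
    becoming shortest for B'. On the machine, [S] is a sum of squares because that needs no absolute
    value. The square root takes O(log P) rounds. Since log P is cubic in the size of the input,
    both the number of instructions and the cost of one are cubic, whence the exponent 6. *)

Definition ram := nat -> int.

(* A piece of code is a function of the address at which it is placed. *)
Definition code := nat -> seq instr.

Definition bounded (G : nat) (f : ram) := forall x, `|f x| <= G.

Definition code_at (P : program) (p : nat) (l : seq instr) :=
  exists P1 P2, P = P1 ++ l ++ P2 /\ size P1 = p.

(** Quantifying over the remaining fuel lets executions compose by adding their step counts. *)
Definition reach (O : oracle) (P : program) (st st' : state) :=
  exists k, forall fuel, run O P (k + fuel) st = run O P fuel st'.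

(** Code addresses only cells below 16 directly, each of cost at most 4. The dearest instruction
    pays for three addresses, two values and 1. *)
Definition unit_cost (G : nat) := 20 + 2 * bln G.

(* Keeping every memory cell bounded by [G] makes each instruction cost at most
   [unit_cost G], so that [t] only counts executed instructions. *)
Definition triple (G t : nat) (A : ram -> Prop) (c : code) (A' : ram -> Prop) :=
  forall O P p f w qs, code_at P p (c p) -> bounded G f -> A f ->
  exists f' w', reach O P (State p f w qs) (State (p + size (c p)) f' w' qs)
    /\ w' <= w + t * unit_cost G /\ bounded G f' /\ A' f'.

Definition block (l : seq instr) : code := fun=> l.

Definition seqc (c1 c2 : code) : code :=
  fun p => c1 p ++ c2 (p + size (c1 p)).

Definition while (a b : nat) (c : code) : code := fun p =>
  [:: IJlt a b p.+2; IJmp (p.+3 + size (c p.+2))] ++ c p.+2 ++ [:: IJmp p].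

Lemma reach_trans O P st1 st2 st3 :
  reach O P st1 st2 -> reach O P st2 st3 -> reach O P st1 st3.
Proof.
move=> [k1 h1] [k2 h2]; exists (k1 + k2) => fuel.
by rewrite -addnA h1 h2.
Qed.

Lemma reach_refl O P st : reach O P st st.
Proof. by exists 0. Qed.

Lemma reach_step O P st st' : step O P st = Some st' -> reach O P st st'.
Proof. by move=> h; exists 1 => fuel; rewrite add1n /= h. Qed.

Lemma code_at_cat P p l1 l2 : code_at P p (l1 ++ l2) ->
  code_at P p l1 /\ code_at P (p + size l1) l2.
Proof.
move=> [P1 [P2 [-> <-]]]; split.
  by exists P1, (l2 ++ P2); rewrite !catA.
by exists (P1 ++ l1), P2; rewrite !catA size_cat.
Qed.

Lemma code_at_nth P p i l : code_at P p (i :: l) -> nth IHalt P p = i.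
Proof. by move=> [P1 [P2 [-> <-]]]; rewrite nth_cat ltnn subnn. Qed.

Lemma code_at_behead P p i l : code_at P p (i :: l) -> code_at P p.+1 l.
Proof. by rewrite -cat1s => /code_at_cat [_]; rewrite addn1. Qed.

Lemma bln_le (x y : nat) : x <= y -> bln x <= bln y.
Proof. by move=> h; rewrite /bln ltnS leq_trunc_log. Qed.

Lemma bln_reg x : x < 16 -> bln x <= 4.
Proof. by do 16 (case: x => [//|x]). Qed.

Lemma triple_weaken G t t' (A1 A2 : ram -> Prop) c (B1 B2 : ram -> Prop) :
  (forall f, A2 f -> A1 f) -> (forall f, B1 f -> B2 f) -> t <= t' ->
  triple G t A1 c B1 -> triple G t' A2 c B2.
Proof.
move=> hA hB ht h O P p f w qs hc hf hAf.
have [f' [w' [h1 [h2 [h3 h4]]]]] := h O P p f w qs hc hf (hA _ hAf).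
exists f', w'; split=> //; split; last by split=> //; apply: hB.
by apply: (leq_trans h2); rewrite leq_add2l leq_mul2r ht orbT.
Qed.

Lemma triple_seq {G t1 t2 A B C c1 c2} :
  triple G t1 A c1 B -> triple G t2 B c2 C ->
  triple G (t1 + t2) A (seqc c1 c2) C.
Proof.
move=> h1 h2 O P p f w qs /code_at_cat [hc1 hc2] hf hA.
have [f1 [w1 [r1 [l1 [b1 q1]]]]] := h1 O P p f w qs hc1 hf hA.
have [f2 [w2 [r2 [l2 [b2 q2]]]]] := h2 O P _ f1 w1 qs hc2 b1 q1.
exists f2, w2; split; last first.
  by split=> //; rewrite mulnDl addnA (leq_trans l2) // leq_add2r.
by rewrite /seqc size_cat addnA; apply: reach_trans r1 r2.
Qed.

Lemma triple_while G t m a b (I : nat -> ram -> Prop) c :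
  a < 16 -> b < 16 ->
  (forall i f, I i f -> (f a < f b)%R -> i < m) ->
  (forall i, i < m ->
     triple G t (fun f => I i f /\ (f a < f b)%R) c (I i.+1)) ->
  triple G (m * (t + 2) + 2) (I 0) (while a b c)
    (fun f => exists i, I i f /\ ~~ (f a < f b)%R).
Proof.
move=> ha hb hm hbody O P p f w qs hc hf hI.
rewrite /while.
have hc1 := code_at_nth _ _ _ _ hc.
have hcj := code_at_nth _ _ _ _ (code_at_behead _ _ _ _ hc).
have [hcb] := code_at_cat _ _ _ _ (code_at_behead _ _ _ _ (code_at_behead _ _ _ _ hc)).
move=> /code_at_nth hcl.
have jcost g : bounded G g -> forall v, v + (1 + bln a + bln b + bl (g a) + bl (g b))
   <= v + unit_cost G.
  move=> hg v; rewrite leq_add2l /unit_cost.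
  have := bln_reg _ ha; have := bln_reg _ hb.
  have := bln_le _ _ (hg a); have := bln_le _ _ (hg b).
  rewrite /bl -!/(bln _); lia.
have jmpc : 1 <= unit_cost G by rewrite /unit_cost; lia.
suff key k i : m - i = k -> forall f w, bounded G f -> I i f ->
    exists f' w', reach O P (State p f w qs)
        (State (p + size (while a b c p)) f' w' qs)
      /\ w' <= w + (k * (t + 2) + 2) * unit_cost G /\ bounded G f'
      /\ exists i, I i f' /\ ~~ (f' a < f' b)%R.
  by apply: (key m 0) => //; rewrite subn0.
elim: k i {f w hf hI} => [|k IH] i hk f w hf hI.
  have hlt : ~~ (f a < f b)%R.
    apply/negP => /(hm _ _ hI); lia.
  exists f, (w + (1 + bln a + bln b + bl (f a) + bl (f b)) + 1); split; last first.
    split; last by split=> //; exists i.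
    have := jcost _ hf w; nia.
  apply: (@reach_trans O P _ (State p.+1 f (w + (1 + bln a + bln b + bl (f a) + bl (f b))) qs)).
    by apply: reach_step; rewrite /step /= hc1 (negbTE hlt).
  apply: reach_step; rewrite /step /= hcj; congr (Some (State _ _ _ _)).
    by rewrite size_cat /=; lia.
  by rewrite addn1.
case hlt: (f a < f b)%R; last first.
  exists f, (w + (1 + bln a + bln b + bl (f a) + bl (f b)) + 1); split; last first.
    split; last by split=> //; exists i; rewrite hlt.
    have := jcost _ hf w; nia.
  apply: (@reach_trans O P _ (State p.+1 f (w + (1 + bln a + bln b + bl (f a) + bl (f b))) qs)).
    by apply: reach_step; rewrite /step /= hc1 hlt.
  apply: reach_step; rewrite /step /= hcj; congr (Some (State _ _ _ _)).
    by rewrite size_cat /=; lia.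
  by rewrite addn1.
have him := hm _ _ hI hlt.
have [f1 [w1 [r1 [l1 [b1 q1]]]]] := hbody i him O P p.+2 f
  (w + (1 + bln a + bln b + bl (f a) + bl (f b))) qs hcb hf (conj hI hlt).
have [f2 [w2 [r2 [l2 [b2 q2]]]]] := IH i.+1 ltac:(lia) f1 (w1 + 1) b1 q1.
exists f2, w2; split; last first.
  split=> //; apply: (leq_trans l2).
  move: (leq_trans l1 (leq_add (jcost _ hf w) (leqnn _))) jmpc.
  rewrite (_ : (k.+1 * (t + 2) + 2) * unit_cost G
    = (k * (t + 2) + 2) * unit_cost G + t * unit_cost G + 2 * unit_cost G); last ring.
  lia.
apply: reach_trans r2.
apply: (@reach_trans O P _ (State p.+2 f (w + (1 + bln a + bln b + bl (f a) + bl (f b))) qs)).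
  by apply: reach_step; rewrite /step /= hc1 hlt.
apply: (reach_trans _ _ _ _ _ r1).
by apply: reach_step; rewrite /step /= hcl addn1.
Qed.

(** A copy of [upd] under another name: [simp_wp] unfolds it, so that register lookups compute, and
    leaves heap updates folded. *)
Definition rupd (r : ram) (d : nat) (z : int) : ram :=
  fun x => if x == d then z else r x.

(* Instructions address cells 0 to 15 directly and reach the other ones only
   through loads and stores: [r] is the register bank and [h] the heap. *)
Definition glue (r h : ram) : ram := fun x => if x < 16 then r x else h x.

Lemma glueK f : glue f f = f.
Proof. by apply/funext => x; rewrite /glue; case: ifP. Qed.

Lemma glue_heap r h x : 16 <= x -> glue r h x = h x.
Proof. by move=> hx; rewrite /glue ltnNge hx. Qed.

Lemma upd_glue_reg r h d z : d < 16 -> upd (glue r h) d z = glue (rupd r d z) h.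
Proof.
move=> hd; apply/funext => x; rewrite /upd /glue /rupd.
by case: eqP => [->|//]; rewrite hd.
Qed.

Lemma upd_glue_heap r h d z : 16 <= d -> upd (glue r h) d z = glue r (upd h d z).
Proof.
move=> hd; apply/funext => x; rewrite /upd /glue.
by case: eqP => [->|//]; rewrite ltnNge hd.
Qed.

(** The result is an existential witness, so that a proof chooses the closed form under which the
    value is carried on. *)
Definition binop_wp (G : nat) (op : int -> int -> int) (r : ram) d a b
    (Q : ram -> Prop) :=
  exists z, op (r a) (r b) = z /\ `|z| <= G /\ Q (rupd r d z).

(** A store may land on a register: this happens for [n = 0], where the first pointer of
    [save_low_cells] is 0. *)
Fixpoint wp (G : nat) (l : seq instr) (r h : ram) (Q : ram -> ram -> Prop) : Prop :=
  match l with
  | [::] => Q r h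
  | i :: l =>
    match i with
    | IConst d c => `|c| <= G /\ wp G l (rupd r d c) h Q
    | IAdd d a b => binop_wp G +%R r d a b (fun r => wp G l r h Q)
    | ISub d a b => binop_wp G (fun x y => x - y)%R r d a b (fun r => wp G l r h Q)
    | IMul d a b => binop_wp G *%R r d a b (fun r => wp G l r h Q)
    | IDiv d a b => binop_wp G (fun x y => x %/ y)%Z r d a b (fun r => wp G l r h Q)
    | ILoad d a => exists x, `|r a| = x /\ wp G l (rupd r d (glue r h x)) h Q
    | IStore a s => exists x, `|r a| = x /\
        (16 <= x /\ wp G l r (upd h x (r s)) Q
         \/ x < 16 /\ wp G l (rupd r x (r s)) h Q)
    | _ => False
    end
  end.

Definition reg_instr (i : instr) : bool :=
  match i with
  | IConst d c => d < 16
  | IAdd d a b | ISub d a b | IMul d a b | IDiv d a b =>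
      [&& d < 16, a < 16 & b < 16]
  | ILoad d a | IStore d a => (d < 16) && (a < 16)
  | _ => false
  end.

Lemma bounded_upd G f d z : bounded G f -> `|z| <= G -> bounded G (upd f d z).
Proof. by move=> hf hz x; rewrite /upd; case: ifP. Qed.

Lemma bl_le G z : `|z| <= G -> bl z <= bln G.
Proof. exact: bln_le. Qed.

Lemma wp_sound G l (A' : ram -> Prop) O P : all reg_instr l ->
  forall p r h w qs, code_at P p l -> bounded G (glue r h) ->
  wp G l r h (fun r h => A' (glue r h)) ->
  exists f' w', reach O P (State p (glue r h) w qs) (State (p + size l) f' w' qs)
    /\ w' <= w + size l * unit_cost G /\ bounded G f' /\ A' f'.
Proof.
elim: l => [_|i l IH /= /andP[hi hl]] p r h w qs hc hb.
  move=> hQ; exists (glue r h), w; rewrite /= addn0; split; first exact: reach_refl.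
  by rewrite mul0n addn0.
have hn := code_at_nth _ _ _ _ hc; have hc' := code_at_behead _ _ _ _ hc.
suff key r' h' w' : bounded G (glue r' h') -> w' <= w + unit_cost G ->
   step O P (State p (glue r h) w qs) = Some (State p.+1 (glue r' h') w' qs) ->
   wp G l r' h' (fun r h => A' (glue r h)) ->
   exists f'' w'', reach O P (State p (glue r h) w qs) (State (p + (size l).+1) f'' w'' qs)
    /\ w'' <= w + (size l).+1 * unit_cost G /\ bounded G f'' /\ A' f''.
  have hmk x : x < 16 -> glue r h x = r x by rewrite /glue => ->.
  have arith_ok op d a b : d < 16 -> a < 16 -> b < 16 ->
     binop_wp G op r d a b (fun r => wp G l r h (fun r h => A' (glue r h))) ->
     step O P (State p (glue r h) w qs) = Some (arith op (State p (glue r h) w qs) d a b) ->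
     exists f'' w'', reach O P (State p (glue r h) w qs) (State (p + (size l).+1) f'' w'' qs)
    /\ w'' <= w + (size l).+1 * unit_cost G /\ bounded G f'' /\ A' f''.
    move=> hd ha hb' [z [hz [hzG hq]]] hs.
    have E : upd (glue r h) d z = glue (rupd r d z) h by rewrite upd_glue_reg.
    apply: (key (rupd r d z) h
       (w + (1 + bln d + bln a + bln b + bl (glue r h a) + bl (glue r h b)))) => //.
    - by rewrite -E; apply: bounded_upd.
    - have := bl_le _ _ (hb a); have := bl_le _ _ (hb b).
      have := bln_reg _ hd; have := bln_reg _ ha; have := bln_reg _ hb'.
      rewrite /unit_cost; lia.
    by rewrite hs /arith /= -E !hmk // hz.
  case: i hn hi {IH hc} => [d c|d a b|d a b|d a b|d a b|d a|a s|||| ] hn //= hi.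
  - move=> [hcG hq]; apply: (key (rupd r d c) h (w + (1 + bln d + bl c))) => //.
    + by rewrite -upd_glue_reg //; apply: bounded_upd.
    + have := bl_le _ _ hcG; have := bln_reg _ hi; rewrite /unit_cost; lia.
    by rewrite /step /= hn upd_glue_reg.
  - by case/and3P: hi => *; apply: (@arith_ok +%R d a b) => //; rewrite /step /= hn.
  - by case/and3P: hi => *; apply: (@arith_ok (fun x y => x - y)%R d a b) => //; rewrite /step /= hn.
  - by case/and3P: hi => *; apply: (@arith_ok *%R d a b) => //; rewrite /step /= hn.
  - by case/and3P: hi => *; apply: (@arith_ok (fun x y => x %/ y)%Z d a b) => //; rewrite /step /= hn.
  - case/andP: hi => hd ha [x [hx hq]].
    apply: (key (rupd r d (glue r h x)) h
      (w + (1 + bln d + bln a + bl (glue r h a) + bl (glue r h x)))) => //.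
    + by rewrite -upd_glue_reg //; apply: bounded_upd.
    + have := bl_le _ _ (hb a); have := bl_le _ _ (hb x).
      have := bln_reg _ hd; have := bln_reg _ ha; rewrite /unit_cost; lia.
    by rewrite /step /= hn -upd_glue_reg // (hmk a) // hx.
  - case/andP: hi => ha hs [x [hx hQ]].
    have [r' [h' [E hq]]] : exists r' h', upd (glue r h) x (r s) = glue r' h' /\
        wp G l r' h' (fun r h => A' (glue r h)).
      case: hQ => [[hx16 hq]|[hx16 hq]].
        by exists r, (upd h x (r s)); rewrite upd_glue_heap.
      by exists (rupd r x (r s)), h; rewrite upd_glue_reg.
    apply: (key r' h'
      (w + (1 + bln a + bln s + bl (glue r h a) + bl (glue r h s)))) => //.
    + by rewrite -E; apply: bounded_upd; rewrite -?(hmk s).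
    + have := bl_le _ _ (hb a); have := bl_le _ _ (hb s).
      have := bln_reg _ ha; have := bln_reg _ hs; rewrite /unit_cost; lia.
    by rewrite /step /= hn -E !hmk // hx.
move=> hb' hw' hs hq.
have [f'' [w'' [h1 [h2 [h3 h4]]]]] := IH hl p.+1 r' h' w' qs hc' hb' hq.
exists f'', w''; split; last first.
  by split=> //; rewrite mulSn addnA (leq_trans h2) // leq_add2r.
by apply: reach_trans (reach_step _ _ _ _ hs) _; rewrite addnS -addSn.
Qed.

Lemma triple_block G l (A A' : ram -> Prop) : all reg_instr l ->
  (forall f, A f -> wp G l f f (fun r h => A' (glue r h))) ->
  triple G (size l) A (block l) A'.
Proof.
move=> hl hw O P p f w qs hc hf hA; rewrite -(glueK f).
by apply: wp_sound => //; rewrite ?glueK //; apply: hw.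
Qed.

Fixpoint seqs (c : nat -> code) (m : nat) : code :=
  if m is m'.+1 then seqc (seqs c m') (c m') else block [::].

Lemma triple_seqs G t m (I : nat -> ram -> Prop) (c : nat -> code) :
  (forall i, i < m -> triple G t (I i) (c i) (I i.+1)) ->
  triple G (m * t) (I 0) (seqs c m) (I m).
Proof.
elim: m => [|m IH] hc; first by apply: (@triple_block G [::]) => // f; rewrite /= glueK.
rewrite mulSn addnC; apply: triple_seq; last exact: hc.
by apply: IH => i hi; apply: hc; apply: ltnW.
Qed.

End Framework.

Ltac simp_wp := rewrite /binop_wp /rupd /=.
Ltac wp_op z := simp_wp; exists z; split; [try lia | split; [try lia |]].
Ltac wp_load x := simp_wp; exists x; split; [try lia |].
Ltac wp_store x := simp_wp; exists x; split; [try lia | left; split; [try lia |]].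
Ltac wp_const := simp_wp; split; [try lia |].

(** * The program up to the oracle call *)

Section Programs.
Local Open Scope nat_scope.

(* The input fills cells 0 to n^2 and every operand is a constant address, so
   there is no scratch register at the start: cell 0 becomes the pointer
   64 n^2, which is where cell 1 goes, and cells d = 2, ..., 15 are then saved
   at H + d - 1, with H = 64 n^2 + 64. *)
Definition save_low_cells : code :=
  seqc (block ([:: IMul 0 0 0; IAdd 0 0 0; IAdd 0 0 0; IAdd 0 0 0; IAdd 0 0 0;
                   IAdd 0 0 0; IAdd 0 0 0; IStore 0 1;
                   IConst 1 64; IAdd 0 0 1; IConst 1 1]))
       (seqs (fun i => block [:: IAdd 0 0 1; IStore 0 i.+2]) 14).

(* Cell 0 no longer holds n, which is found again as the least i with
   64 i^2 >= 64 n^2. *)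
Definition recover_size : code :=
  seqc (block [:: IConst 5 14; ISub 3 0 5; IConst 5 64; ISub 0 3 5;
                  ILoad 6 0; IStore 3 6; IConst 2 0; IConst 5 0])
  (seqc (while 5 0 (block [:: IAdd 2 2 1; IMul 5 2 2; IConst 4 64; IMul 5 5 4]))
        (block [:: IMul 10 2 2; IConst 4 15])).

Definition copy_input : code :=
  while 4 10 (block [:: IAdd 5 4 1; ILoad 6 5; IAdd 5 3 4; IStore 5 6; IAdd 4 4 1]).

Variables (n G : nat) (b : nat -> int).

(** The factor 64 comes from six doublings of cell 0, possible without a second register. For
    [n > 0] the address [64 n^2] lies beyond both the registers and the input, and the query, which
    ends at cell [n^2 + 16], stays below [base_addr]. *)
Definition base_addr := 64 * (n * n) + 64.

Hypothesis hb0 : forall k, n * n <= k -> b k = 0.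
Hypothesis hG : 66 * (n * n) + n + 200 <= G.

Definition input_at (f : ram) :=
  forall x, f x = if x == 0 then n%:Z else b x.-1.

Lemma save_low_cells_ok : triple G 39 input_at save_low_cells
  (fun f => [/\ f 0 = Posz (base_addr + 14), f 1 = 1,
     0 < n -> f (64 * (n * n)) = b 0,
     forall k, 0 < k < 15 -> f (base_addr + k) = b k
   & forall k, 15 <= k -> f k.+1 = (if k.+1 == 64 * (n * n) then b 0 else
       if base_addr < k.+1 < base_addr + 15 then b (k.+1 - base_addr) else b k)]).
Proof.
have E : base_addr = 64 * (n * n) + 64 by [].
move: base_addr E => H E.
pose I i (f : ram) := [/\ f 0 = Posz (H + i), f 1 = 1,
  forall d, 2 <= d < 16 -> f d = b d.-1 
  & forall x, 16 <= x -> f x = if x == 64 * (n * n) then b 0 else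
       if H < x <= H + i then b (x - H) else b x.-1].
apply: (@triple_weaken G 39 39 input_at _ _ (I 14)) => //.
  move=> f [h0 h1 h2 h3]; split=> //.
  - by move=> hn; rewrite h3 ?eqxx //; nia.
  - move=> k hk; rewrite h3; last lia.
    rewrite ifF; last lia. by rewrite ifT; [congr b|]; lia.
  - move=> k hk; rewrite h3; last lia.
    by rewrite (_ : (H < k.+1 <= H + 14) = (H < k.+1 < H + 15)) //; lia.
apply: (@triple_seq G 11 28 _ (I 0)); last first.
  apply: (@triple_seqs G 2 14 I) => i hi.
  apply: triple_block => [|f [h0 h1 h2 h3]].
    by rewrite /=; lia.
  wp_op (Posz (H + i.+1)). wp_store (H + i.+1).
  split=> //=.
  - by move=> d hd; rewrite /glue ifT; last lia; rewrite ifF; [apply: h2|]; lia.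
  - move=> x hx; rewrite glue_heap // /upd; case: eqP => [->|hne].
      by rewrite ifF ?ifT; [rewrite h2; [congr b|]| |]; lia.
    rewrite h3 //; case: ifP => // _.
    by rewrite (_ : (H < x <= H + i.+1) = (H < x <= H + i)) //; lia.
apply: triple_block => // f hf.
have f0 : f 0 = n by rewrite hf.
have f1 : f 1 = b 0 by rewrite hf.
have hfx x : 0 < x -> f x = b x.-1 by move=> h; rewrite hf ifF //; lia.
wp_op (Posz (n * n)). wp_op (Posz (2 * (n * n))). wp_op (Posz (4 * (n * n))).
wp_op (Posz (8 * (n * n))). wp_op (Posz (16 * (n * n))). wp_op (Posz (32 * (n * n))).
wp_op (Posz (64 * (n * n))). simp_wp. exists (64 * (n * n)); split => //.
(* For [n = 0] the store copies cell 1, which is 0, onto cell 0, which is 0 as well. *)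
case: (posnP n) => hn.
  right; split; first lia.
  have f10 : f 1 = 0 by rewrite f1 hb0 // hn.
  rewrite (_ : 64 * (n * n) = 0); last lia.
  wp_const. wp_op (Posz H).
  wp_const. split=> //=.
  - by rewrite addn0.
  - move=> d hd; rewrite /glue ifT; last lia.
    have d0 : (d == 0) = false by lia. have d1 : (d == 1) = false by lia.
    by rewrite ?d0 ?d1 hfx //; lia.
  - move=> x hx; rewrite glue_heap // ifF; last lia.
    by rewrite ifF; [rewrite hfx|]; lia.
left; split; first nia.
wp_const. wp_op (Posz H). wp_const. split=> //=.
- by rewrite addn0.
- move=> d hd; rewrite /glue ifT; last lia.
  have d0 : (d == 0) = false by lia. have d1 : (d == 1) = false by lia.
  by rewrite ?d0 ?d1 hfx //; lia.
- move=> x hx; rewrite glue_heap // /upd f1; case: eqP => // _.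
  by rewrite ifF; [rewrite hfx|]; lia.
Qed.

(* B is stored from H on, and the n zeros that follow it are the accumulator of
   the output vector. *)
Definition has_base (f : ram) := [/\ f 1 = 1, f 2 = n, f 3 = Posz base_addr,
  f 10 = Posz (n * n) & forall k, k < n * n + n -> f (base_addr + k) = b k].

Lemma has_base_glue f r h : has_base f ->
  r 1 = f 1 -> r 2 = f 2 -> r 3 = f 3 -> r 10 = f 10 ->
  (forall k, k < n * n + n -> h (base_addr + k) = f (base_addr + k)) ->
  has_base (glue r h).
Proof.
move=> [h1 h2 h3 h10 hh] e1 e2 e3 e10 eh; split.
- by rewrite /glue /= e1.
- by rewrite /glue /= e2.
- by rewrite /glue /= e3.
- by rewrite /glue /= e10.
by move=> k hk; rewrite glue_heap ?eh ?hh //; rewrite /base_addr; lia.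
Qed.

(** Entry 15 is the first whose input cell, 16, is not a register, so from there on the input is
    still in place. The last clause keeps track of the zeros that follow the matrix. *)
Definition half_moved m (f : ram) := [/\ f 1 = 1, f 3 = Posz base_addr,
  forall k, k < n * n + n -> k < m -> f (base_addr + k) = b k,
  forall k, 15 <= k < n * n -> f k.+1 = b k
  & forall k, 15 <= k -> n * n <= k -> f (base_addr + k) = 0].

Lemma half_moved_glue m f r h : half_moved m f -> r 1 = f 1 -> r 3 = f 3 ->
  (forall x, 16 <= x -> h x = f x) -> half_moved m (glue r h).
Proof.
move=> [h1 h3 h4 h5 h6] e1 e3 eh; split.
- by rewrite /glue /= e1.
- by rewrite /glue /= e3.
- by move=> k hk hm; rewrite glue_heap ?eh ?h4 //; rewrite /base_addr; lia.
- by move=> k hk; rewrite glue_heap ?eh ?h5 //; lia.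
by move=> k hk hm; rewrite glue_heap ?eh ?h6 //; rewrite /base_addr; lia.
Qed.

Lemma recover_size_ok : triple G (8 + (n * (4 + 2) + 2 + 2))
  (fun f => [/\ f 0 = Posz (base_addr + 14), f 1 = 1,
     0 < n -> f (64 * (n * n)) = b 0,
     forall k, 0 < k < 15 -> f (base_addr + k) = b k
   & forall k, 15 <= k -> f k.+1 = (if k.+1 == 64 * (n * n) then b 0 else
       if base_addr < k.+1 < base_addr + 15 then b (k.+1 - base_addr) else b k)])
  recover_size
  (fun f => [/\ half_moved 15 f, f 2 = n, f 4 = 15 & f 10 = Posz (n * n)]).
Proof.
have E : base_addr = 64 * (n * n) + 64 by [].
pose I i f := [/\ half_moved 15 f, f 2 = Posz i, f 0 = Posz (64 * (n * n)),
  i <= n & f 5 = Posz (64 * (i * i))].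
apply: (@triple_seq G 8 _ _ (I 0)).
  apply: triple_block => // f [h0 h1 h2 h3 h4].
  wp_const. wp_op (Posz base_addr). wp_const. wp_op (Posz (64 * (n * n))).
  wp_load (64 * (n * n)). wp_store base_addr. wp_const. wp_const.
  split=> //=; split=> //=.
  - move=> k hk hk15; rewrite glue_heap; last lia.
    rewrite /upd; case: eqP => hk0.
      have -> : k = 0 by lia.
      have hn : 0 < n by lia.
      by rewrite glue_heap ?h2 //; nia.
    by apply: h3; lia.
  - move=> k hk; rewrite glue_heap; last lia.
    rewrite /upd ifF; last lia.
    rewrite h4; last lia.
    by rewrite ifF; [rewrite ifF|]; lia.
  move=> k hk hkn; rewrite glue_heap; last lia.
  rewrite /upd ifF; last lia.
  rewrite (_ : base_addr + k = (base_addr + k).-1.+1); last lia.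
  rewrite h4; last lia.
  by rewrite ifF; [rewrite ifF; [apply: hb0|]|]; lia.
apply: (triple_seq (B := fun f => I n f)).
  apply: (@triple_weaken G (n * (4 + 2) + 2) _ (I 0) _ _
    (fun f => exists i, I i f /\ ~~ (f 5 < f 0)%R)) => //.
    move=> f [i [[h1 h2 h3 h4 h5] hlt]]; suff -> : n = i by [].
    by move: hlt; rewrite h3 h5; nia.
  apply: triple_while => //.
    by move=> i f [h1 h2 h3 h4 h5]; rewrite h3 h5; nia.
  move=> i hi; apply: (@triple_block G [:: _; _; _; _]) => // f [[h1 h2 h3 h4 h5] _].
  have hii : i.+1 * i.+1 <= n * n by nia.
  have [f1 _ _ _ _] := h1.
  wp_op (Posz i.+1). wp_op (Posz (i.+1 * i.+1)). wp_const.
  wp_op (Posz (64 * (i.+1 * i.+1))).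
  by split=> //; apply: (half_moved_glue _ f).
apply: (@triple_block G [:: _; _]) => // f [h1 h2 h3 h4 h5].
wp_op (Posz (n * n)). wp_const.
by split=> //; apply: (half_moved_glue _ f).
Qed.

Lemma copy_input_ok : triple G (n * n * (5 + 2) + 2)
  (fun f => [/\ half_moved 15 f, f 2 = n, f 4 = 15 & f 10 = Posz (n * n)])
  copy_input has_base.
Proof.
have E : base_addr = 64 * (n * n) + 64 by [].
pose I i f := [/\ half_moved (15 + i) f, f 2 = n, f 4 = Posz (15 + i)
  & f 10 = Posz (n * n)].
apply: (@triple_weaken G (n * n * (5 + 2) + 2) _ (I 0) _ _
    (fun f => exists i, I i f /\ ~~ (f 4 < f 10)%R)) => //.
  move=> f [i [[[h1 h3 h5 h6 h7] h2 h4 h10] hlt]]; split=> // k hk.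
  have {}hlt : n * n <= 15 + i by move: hlt; rewrite h4 h10; lia.
  case: (ltnP k (15 + i)) => hki; first exact: h5.
  by rewrite h7 ?hb0 //; lia.
apply: triple_while => //.
  by move=> i f [h1 h2 h3 h4]; rewrite h3 h4; lia.
move=> i hi; apply: (@triple_block G [:: _; _; _; _; _]) => //.
move=> f [[[h1 h3 h5 h6 h7] h2 h4 h10] hlt].
have {}hlt : 15 + i < n * n by move: hlt; rewrite h4 h10; lia.
wp_op (Posz (15 + i).+1). wp_load (15 + i).+1. wp_op (Posz (base_addr + (15 + i))).
wp_store (base_addr + (15 + i)). wp_op (Posz (15 + i.+1)).
split=> //=; split=> //=.
- move=> k hk hki; rewrite glue_heap; last lia.
  rewrite /upd; case: eqP => hne; last by apply: h5; lia.
  by rewrite glue_heap // h6; [congr b|]; lia.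
- by move=> k hk; rewrite glue_heap /upd ?ifF ?h6 //; lia.
by move=> k hk hkn; rewrite glue_heap /upd ?ifF ?h7 //; lia.
Qed.

End Programs.

(** * The constants S, T, K, P, N, their computation, and the query matrix *)

Section Bounds.
Local Open Scope nat_scope.
Variables (n : nat) (b : nat -> int).

(** Since [|z| <= z ^ 2] for integers, this one number dominates [n], the l1 norm of every row and
    the squared length of every column. *)
Definition norm_bound := n.+1 + \sum_(0 <= k < n * n) `|b k| ^ 2.
Definition coef_bound := norm_bound ^ n.+1.
Definition radix := 4 * coef_bound.
Definition code_bound := radix ^ n.+1.
Definition scale := code_bound * code_bound.

Lemma norm_bound_gt : n < norm_bound.
Proof. by rewrite /norm_bound; lia. Qed.

Lemma norm_bound_ge k : k < n * n -> `|b k| ^ 2 <= norm_bound.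
Proof.
move=> hk; rewrite /norm_bound (big_cat_nat (n := k)) //=; last exact: ltnW.
by rewrite (big_ltn hk); lia.
Qed.

Lemma entry_le k : k < n * n -> `|b k| <= norm_bound.
Proof.
move=> /norm_bound_ge; apply: leq_trans; case: `|b k| => [|m] //.
by rewrite -{1}(expn1 m.+1) leq_pexp2l.
Qed.

Lemma partial_sum_le m : m <= n * n ->
  n.+1 + \sum_(0 <= k < m) `|b k| ^ 2 <= norm_bound.
Proof.
by move=> hm; rewrite /norm_bound (big_cat_nat (n := m) (p := n * n)) //=; lia.
Qed.

Lemma coef_pow_le i : i <= n -> norm_bound ^ i.+1 <= coef_bound.
Proof.
by move=> hi; rewrite leq_pexp2l //; have := norm_bound_gt; lia.
Qed.

Lemma norm_le_coef : norm_bound <= coef_bound.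
Proof. by rewrite -{1}(expn1 norm_bound) coef_pow_le. Qed.

Lemma size_lt_coef : n * n < coef_bound.
Proof.
have hn := norm_bound_gt; have := norm_le_coef.
case: (posnP n) => [->|hp] //; first by lia.
move=> _; apply: leq_trans (coef_pow_le 1 hp).
by rewrite expnS expn1; nia.
Qed.

Lemma radix_pow_le i : i <= n -> radix ^ i.+1 <= code_bound.
Proof.
move=> hi; rewrite leq_pexp2l // /radix.
by have := size_lt_coef; lia.
Qed.

Lemma radix_le_code : radix <= code_bound.
Proof. by rewrite -{1}(expn1 radix) radix_pow_le. Qed.

Lemma radix_sqr_le : radix * radix <= scale.
Proof. by rewrite leq_mul ?radix_le_code. Qed.

(** Collects what the arithmetic tactics are told about the constants, whose powers they cannot
    evaluate. *)
Lemma param_facts : [/\ n < norm_bound, n * n < coef_bound,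
   norm_bound <= coef_bound, radix = 4 * coef_bound & radix <= code_bound]
  /\ [/\ code_bound <= scale, scale <= norm_bound * scale &
   norm_bound * coef_bound <= scale ].
Proof.
have h1 := norm_bound_gt; have h2 := size_lt_coef; have h3 := norm_le_coef.
have h4 := radix_le_code; have h5 := radix_sqr_le.
have h6 : radix = 4 * coef_bound by [].
split; split => //.
- by rewrite /scale leq_pmulr //; lia.
- by rewrite leq_pmull //; lia.
by nia.
Qed.

Definition compute_norm_bound : code :=
  seqc (block [:: IAdd 7 2 1; IConst 4 0])
    (while 4 10 (block [:: IAdd 5 3 4; ILoad 6 5; IMul 6 6 6; IAdd 7 7 6; IAdd 4 4 1])).

(** Register 1 permanently holds 1, so [IMul d a 1] serves as the move instruction here and
    below. *)
Definition compute_coef_bound : code :=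
  seqc (block [:: IMul 8 7 1; IConst 4 0])
    (while 4 2 (block [:: IMul 8 8 7; IAdd 4 4 1])).

Definition compute_code_bound : code :=
  seqc (block [:: IAdd 11 8 8; IAdd 8 11 11; IMul 9 8 1; IConst 4 0])
    (while 4 2 (block [:: IMul 9 9 8; IAdd 4 4 1])).

Definition scale_matrix : code :=
  seqc (block [:: IMul 12 9 1; IMul 9 9 12; IConst 4 0; IConst 13 17])
    (while 4 10 (block [:: IAdd 5 3 4; ILoad 6 5; IMul 6 6 9; IAdd 5 13 4;
                           IStore 5 6; IAdd 4 4 1])).

Definition perturb_matrix : code :=
  seqc (block [:: IConst 4 0; IConst 14 1])
  (seqc (while 4 2 (block [:: IAdd 5 13 4; ILoad 6 5; IAdd 6 6 14; IStore 5 6;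
                              IMul 14 14 8; IAdd 4 4 1]))
        (block [:: IConst 5 16; IStore 5 2])).

Variable G : nat.
Hypothesis hG : 512 * (norm_bound * scale) <= G.

Let Hb := base_addr n.
Let HbE : Hb = 64 * (n * n) + 64. Proof. by []. Qed.

Let facts := param_facts.

Lemma addr_le : 66 * (n * n) + n + 200 <= G.
Proof. by case: facts => -[h1 h2 h3 h4 h5] [h6 h7 h8]; lia. Qed.

Lemma compute_norm_bound_ok : triple G (2 + (n * n * (5 + 2) + 2))
  (has_base n b) compute_norm_bound
  (fun f => has_base n b f /\ f 7 = norm_bound).
Proof.
have hG0 := addr_le; case: facts => -[h1 h2 h3 h4 h5] [h6 h7 h8].
pose I i f := [/\ has_base n b f, f 4 = Posz i, i <= n * n &
   f 7 = Posz (n.+1 + \sum_(0 <= k < i) `|b k| ^ 2)].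
apply: (@triple_seq G 2 _ _ (I 0)).
  apply: (@triple_block G [:: _; _]) => // f B; have [f1 f2 _ _ _] := B.
  wp_op (Posz n.+1). wp_const.
  split=> //; first by apply: has_base_glue B _ _ _ _ _.
  by rewrite big_geq // addn0.
apply: (@triple_weaken G (n * n * (5 + 2) + 2) _ (I 0) _ _
    (fun f => exists i, I i f /\ ~~ (f 4 < f 10)%R)) => //.
  move=> f [i [[B f4 hi f7]]]; have [_ _ _ f10 _] := B.
  move=> hlt; have E : n * n = i by move: hlt; rewrite f4 f10; lia.
  by split=> //; rewrite f7 /norm_bound E.
apply: triple_while => //.
  by move=> i f [B f4 hi f7]; have [_ _ _ f10 _] := B; rewrite f4 f10; lia.
move=> i hi; apply: (@triple_block G [:: _; _; _; _; _]) => //.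
move=> f [[B f4 _ f7] _]; have [f1 f2 f3 f10 fb] := B.
have hs := partial_sum_le i.+1 hi.
have bi : f (Hb + i) = b i by apply: fb; lia.
have E : Posz (n.+1 + \sum_(0 <= k < i.+1) `|b k| ^ 2) =
   (f 7 + b i * b i)%R.
  by rewrite big_nat_recr //= f7; nia.
wp_op (Posz (Hb + i)). wp_load (Hb + i). rewrite glue_heap; last lia. rewrite bi.
have hb2 : `|b i| ^ 2 <= norm_bound by apply: norm_bound_ge.
simp_wp. exists (b i * b i)%R; split=> //; split; first by nia.
simp_wp. exists (Posz (n.+1 + \sum_(0 <= k < i.+1) `|b k| ^ 2)).
split; first by rewrite E. split; first lia. wp_op (Posz i.+1).
by split=> //; apply: has_base_glue B _ _ _ _ _.
Qed.

Lemma compute_coef_bound_ok : triple G (2 + (n * (2 + 2) + 2))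
  (fun f => has_base n b f /\ f 7 = norm_bound) compute_coef_bound
  (fun f => has_base n b f /\ f 8 = coef_bound).
Proof.
have hG0 := addr_le; case: facts => -[h1 h2 h3 h4 h5] [h6 h7 h8].
pose I i f := [/\ has_base n b f, f 7 = norm_bound, f 4 = Posz i, i <= n &
   f 8 = Posz (norm_bound ^ i.+1)].
apply: (@triple_seq G 2 _ _ (I 0)).
  apply: (@triple_block G [:: _; _]) => // f [B f7]; have [f1 f2 _ _ _] := B.
  wp_op (Posz norm_bound). wp_const.
  by split=> //; first by apply: has_base_glue B _ _ _ _ _.
apply: (@triple_weaken G (n * (2 + 2) + 2) _ (I 0) _ _
    (fun f => exists i, I i f /\ ~~ (f 4 < f 2)%R)) => //.
  move=> f [i [[B _ f4 hi f8]]]; have [_ f2 _ _ _] := B.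
  move=> hlt; split=> //; rewrite f8; congr (Posz (_ ^ _.+1)).
  by move: hlt; rewrite f4 f2; lia.
apply: triple_while => //.
  by move=> i f [B _ f4 hi _]; have [_ f2 _ _ _] := B; rewrite f4 f2; lia.
move=> i hi; apply: (@triple_block G [:: _; _]) => //.
move=> f [[B f7 f4 _ f8] _]; have [f1 f2 f3 f10 fb] := B.
have hs := coef_pow_le i.+1 hi.
have E : Posz (norm_bound ^ i.+2) = (f 8 * f 7)%R.
  by rewrite f8 f7 -PoszM expnSr.
simp_wp. exists (Posz (norm_bound ^ i.+2)); split; first by rewrite E.
split; first lia. wp_op (Posz i.+1).
by split=> //; apply: has_base_glue B _ _ _ _ _.
Qed.

Definition has_params (f : ram) :=
  [/\ has_base n b f, f 8 = radix, f 11 = Posz (2 * coef_bound),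
      f 12 = code_bound & f 9 = scale].

Lemma compute_code_bound_ok : triple G (4 + (n * (2 + 2) + 2))
  (fun f => has_base n b f /\ f 8 = coef_bound) compute_code_bound
  (fun f => [/\ has_base n b f, f 8 = radix, f 11 = Posz (2 * coef_bound)
     & f 9 = code_bound]).
Proof.
have hG0 := addr_le; case: facts => -[h1 h2 h3 h4 h5] [h6 h7 h8].
pose I i f := [/\ has_base n b f, f 8 = radix /\ f 11 = Posz (2 * coef_bound),
   f 4 = Posz i, i <= n & f 9 = Posz (radix ^ i.+1)].
apply: (@triple_seq G 4 _ _ (I 0)).
  apply: (@triple_block G [:: _; _; _; _]) => // f [B f8]; have [f1 f2 _ _ _] := B.
  wp_op (Posz (2 * coef_bound)). wp_op (Posz radix). wp_op (Posz radix). wp_const.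
  by split=> //; first by apply: has_base_glue B _ _ _ _ _.
apply: (@triple_weaken G (n * (2 + 2) + 2) _ (I 0) _ _
    (fun f => exists i, I i f /\ ~~ (f 4 < f 2)%R)) => //.
  move=> f [i [[B [f8 f11] f4 hi f9]]]; have [_ f2 _ _ _] := B.
  move=> hlt; split=> //; rewrite f9; congr (Posz (_ ^ _.+1)).
  by move: hlt; rewrite f4 f2; lia.
apply: triple_while => //.
  by move=> i f [B _ f4 hi _]; have [_ f2 _ _ _] := B; rewrite f4 f2; lia.
move=> i hi; apply: (@triple_block G [:: _; _]) => //.
move=> f [[B [f8 f11] f4 _ f9] _]; have [f1 f2 f3 f10 fb] := B.
have hs := radix_pow_le i.+1 hi.
have E : Posz (radix ^ i.+2) = (f 9 * f 8)%R.
  by rewrite f9 f8 -PoszM expnSr.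
simp_wp. exists (Posz (radix ^ i.+2)); split; first by rewrite E.
split; first lia. wp_op (Posz i.+1).
by split=> //; apply: has_base_glue B _ _ _ _ _.
Qed.

Lemma scale_matrix_ok : triple G (4 + (n * n * (6 + 2) + 2))
  (fun f => [/\ has_base n b f, f 8 = radix, f 11 = Posz (2 * coef_bound)
     & f 9 = code_bound])
  scale_matrix
  (fun f => [/\ has_params f, f 13 = 17
     & forall k, k < n * n -> f (17 + k) = (b k * scale)%R]).
Proof.
have hG0 := addr_le; case: facts => -[h1 h2 h3 h4 h5] [h6 h7 h8].
pose I i f := [/\ has_params f, f 13 = 17, f 4 = Posz i, i <= n * n
     & forall k, k < i -> f (17 + k) = (b k * scale)%R].
apply: (@triple_seq G 4 _ _ (I 0)).
  apply: (@triple_block G [:: _; _; _; _]) => // f [B f8 f11 f9].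
  have [f1 f2 _ _ _] := B.
  wp_op (Posz code_bound). simp_wp. exists (Posz scale); split.
    by rewrite f9 -PoszM.
  split; first lia. wp_const. wp_const.
  split=> //=; split=> //; first by apply: has_base_glue B _ _ _ _ _.
apply: (@triple_weaken G (n * n * (6 + 2) + 2) _ (I 0) _ _
    (fun f => exists i, I i f /\ ~~ (f 4 < f 10)%R)) => //.
  move=> f [i [[B f13 f4 hi fq]]]; have [[_ _ _ f10 _] _ _ _ _] := B.
  move=> hlt; split=> // k hk; apply: fq; apply: leq_trans hk _.
  by move: hlt; rewrite f4 f10; lia.
apply: triple_while => //.
  move=> i f [B _ f4 hi _]; have [[_ _ _ f10 _] _ _ _ _] := B.
  by rewrite f4 f10; lia.
move=> i hi; apply: (@triple_block G [:: _; _; _; _; _; _]) => //.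
move=> f [[Pf f13 f4 _ fq] _]; have [B f8 f11 f12 f9] := Pf.
have [f1 f2 f3 f10 fb] := B.
have bi : f (Hb + i) = b i by apply: fb; lia.
have hb2 := entry_le i hi.
wp_op (Posz (Hb + i)). wp_load (Hb + i). rewrite glue_heap; last lia. rewrite bi.
simp_wp. exists (b i * scale)%R; split; first by rewrite f9.
split; first by nia.
wp_op (Posz (17 + i)). wp_store (17 + i). wp_op (Posz i.+1).
split=> //=.
  split=> //; apply: has_base_glue B _ _ _ _ _ => // k hk.
  by rewrite /upd ifF //; lia.
move=> k hk; rewrite glue_heap; last lia.
by rewrite /upd; case: eqP => hne; [congr (b _ * _)%R|apply: fq]; lia.
Qed.

(* The oracle reads its dimension in cell 16 and its matrix from cell 17 on. *)
Definition has_query (f : ram) :=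
  [/\ has_params f, f 16 = n & forall k, k < n * n ->
     f (17 + k) = (b k * scale + Posz (if k < n then radix ^ k else 0)%N)%R].

Lemma perturb_matrix_ok : triple G (2 + (n * (6 + 2) + 2 + 2))
  (fun f => [/\ has_params f, f 13 = 17
     & forall k, k < n * n -> f (17 + k) = (b k * scale)%R])
  perturb_matrix has_query.
Proof.
have hG0 := addr_le; case: facts => -[h1 h2 h3 h4 h5] [h6 h7 h8].
pose I i f := [/\ has_params f, f 13 = 17, f 4 = Posz i, 
      i <= n /\ f 14 = Posz (radix ^ i)
     & forall k, k < n * n ->
     f (17 + k) = (b k * scale + Posz (if k < i then radix ^ k else 0)%N)%R].
apply: (@triple_seq G 2 _ _ (I 0)).
  apply: (@triple_block G [:: _; _]) => // f [[B f8 f11 f12 f9] f13 fq].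
  wp_const. wp_const.
  split=> //=; first by split=> //; apply: has_base_glue B _ _ _ _ _.
  by move=> k hk; rewrite addr0; apply: fq.
apply: (triple_seq (B := I n)).
  apply: (@triple_weaken G (n * (6 + 2) + 2) _ (I 0) _ _
      (fun f => exists i, I i f /\ ~~ (f 4 < f 2)%R)) => //.
    move=> f [i [If hlt]]; suff -> : n = i by [].
    have [[[_ f2 _ _ _] _ _ _ _] _ f4 [hi _] _] := If.
    by move: hlt; rewrite f4 f2; lia.
  apply: triple_while => //.
    move=> i f [[[_ f2 _ _ _] _ _ _ _] _ f4 [hi _] _].
    by rewrite f4 f2; lia.
  move=> i hi; apply: (@triple_block G [:: _; _; _; _; _; _]) => //.
  move=> f [[Pf f13 f4 [_ f14] fq] _]; have [B f8 f11 f12 f9] := Pf.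
  have [f1 f2 f3 f10 fb] := B.
  have hin : i < n * n by nia.
  have bi : f (17 + i) = (b i * scale)%R by rewrite fq // ltnn addr0.
  have hb2 := entry_le i hin.
  have hp := radix_pow_le i (ltnW hi).
  have hpi : radix ^ i <= radix ^ i.+1 by rewrite leq_pexp2l //; lia.
  wp_op (Posz (17 + i)). wp_load (17 + i). rewrite glue_heap; last lia. rewrite bi.
  simp_wp. exists (b i * scale + Posz (radix ^ i))%R; split; first by rewrite f14.
  split; first by nia.
  wp_store (17 + i).
  simp_wp. exists (Posz (radix ^ i.+1)); split.
    by rewrite f14 f8 -PoszM expnSr.
  split; first lia.
  wp_op (Posz i.+1).
  split=> //=.
    split=> //; apply: has_base_glue B _ _ _ _ _ => // k hk.
    by rewrite /upd ifF //; lia.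
  move=> k hk; rewrite glue_heap; last lia.
  rewrite /upd; case: eqP => hne.
    by rewrite (_ : k = i); [rewrite ltnSn|lia].
  by rewrite fq // (_ : (k < i.+1) = (k < i)) //; lia.
apply: (@triple_block G [:: _; _]) => // f [[B f8 f11 f12 f9] f13 f4 _ fq].
have [f1 f2 f3 f10 fb] := B.
wp_const. wp_store 16. split=> //=.
split=> //; apply: has_base_glue B _ _ _ _ _ => // k hk.
by rewrite /upd ifF //; lia.
Qed.

End Bounds.

(** * The program after the oracle call *)

Section Decoding.
Local Open Scope nat_scope.

Lemma row_entry_lt n i j : i < n -> j < n -> i * n + j < n * n.
Proof. by move=> hi hj; nia. Qed.

(** From [(x - r)^2 >= 0] one gets [2 r - x <= r^2 / x], and the left side is an integer, so
    flooring preserves it and the iterate stays at or above [r]. The halving comes from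
    [r^2 / x <= r]. *)
Lemma heron_step r x : r < x ->
  r <= (x + r * r %/ x) %/ 2 /\ ((x + r * r %/ x) %/ 2 - r) * 2 <= x - r.
Proof.
move=> hx; set d := r * r %/ x.
have h1 : 2 * r - x <= d.
  rewrite leq_divRL; last lia.
  (* Subtraction is truncated, so the bound is void when [x > 2 r]. *)
  case: (leqP x (2 * r)) => h; last by rewrite (_ : 2 * r - x = 0) //; lia.
  have [e he] : exists e, x = r + e by exists (x - r); lia.
  have [c hc] : exists c, r = e + c by exists (r - e); lia.
  by rewrite he hc (_ : _ - _ = c); [nia|lia].
have h2 : d <= r.
  apply: (@leq_trans (r * x %/ x)); last by rewrite mulnK //; lia.
  by rewrite leq_div2r // leq_mul2l ltnW ?orbT.
lia.
Qed.

(** With floor division only, [q mod 2 N] is [q] minus [2 N] times the quotient. The last two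
    instructions start Heron's iteration at [P], which exceeds [r]. *)
Definition extract_square : code :=
  block [:: IAdd 9 9 9; IDiv 5 0 9; IMul 5 5 9; ISub 0 0 5; IMul 13 12 1; IMul 5 12 12].

(* Heron's iteration; on a perfect square r^2 the distance to r is at least halved. *)
Definition square_root : code :=
  while 0 5 (block [:: IDiv 5 0 13; IAdd 13 13 5; IConst 5 2; IDiv 13 13 5; IMul 5 13 13]).

(** The matrix is stored by rows, so a column is read with stride [n]. Each digit is spent on its
    column as soon as it is known; the vector [y] is never stored. *)
Definition add_column : code :=
  while 6 15 (block [:: ILoad 0 5; IMul 0 0 14; ILoad 7 6; IAdd 7 7 0; IStore 6 7;
                        IAdd 5 5 2; IAdd 6 6 1]).

(* Digits lie in [-T, T] and register 11 holds 2T = K/2, so the quotient of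
   s + K/2 by the radix K drops the lowest digit of s. *)
Definition decode_digits : code :=
  seqc (block [:: IAdd 9 3 10; IConst 4 0])
  (while 4 2
    (seqc (block [:: IAdd 5 13 11; IDiv 5 5 8; IMul 6 5 8; ISub 14 13 6; IMul 13 5 1;
                     IAdd 5 3 4; IMul 6 9 1; IAdd 15 9 2])
    (seqc add_column (block [:: IAdd 4 4 1])))).

(* Outputs 1 to 15 overwrite the registers, hence they are written last, from
   the top down, cell 0 being the pointer and cell 1 the constant one. *)
Definition copy_output : code :=
  seqc (block [:: IConst 4 15])
  (seqc (while 4 2 (block [:: IAdd 5 9 4; ILoad 6 5; IAdd 5 4 1; IStore 5 6; IAdd 4 4 1]))
  (seqc (block [:: IConst 5 14; IAdd 0 9 5])
  (seqc (seqs (fun i => block [:: ILoad (15 - i) 0; ISub 0 0 1]) 14)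
        (block [:: ILoad 1 0])))).

Variables (n G : nat) (b : nat -> int).

Local Notation Sn := (norm_bound n b).
Local Notation T := (coef_bound n b).
Local Notation K := (radix n b).
Local Notation P := (code_bound n b).
Local Notation N := (scale n b).
Hypothesis hb0 : forall k, n * n <= k -> b k = 0.
Hypothesis hG : 512 * (Sn * N) <= G.

Let facts : [/\ n < Sn, n * n < T, Sn <= T, K = 4 * T & K <= P]
  /\ [/\ P <= N, N <= Sn * N & Sn * T <= N ] := param_facts n b.

Local Notation Hb := (base_addr n).
Let HbE : Hb = 64 * (n * n) + 64. Proof. by []. Qed.
Let hG0 : 66 * (n * n) + n + 200 <= G := addr_le n b G hG.

Definition has_matrix (v : nat -> int) (f : ram) :=
  [/\ [/\ f 1 = 1, f 2 = n, f 3 = Hb & f 9 = Posz (Hb + n * n)],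
      f 8 = K, f 11 = Posz (2 * T),
      forall k, k < n * n -> f (Hb + k) = b k &
      forall i, i < n -> f (Hb + n * n + i) = v i].

Variables (q r : nat) (y : nat -> int).
Hypothesis hq : q <= G.
Hypothesis hqr : q %% (N + N) = r * r.
Hypothesis hr : r < P.
Hypothesis hy : forall i, i < n -> `|y i| <= T.

(** What is left of [s] after its [j] lowest balanced digits are dropped. *)
Definition digits_from j : int := (\sum_(j <= i < n) y i * K%:Z ^+ (i - j))%R.
Hypothesis hry : Posz r = digits_from 0.

Definition partial_row i j : int := (\sum_(0 <= k < j) b (i * n + k)%N * y k)%R.

Definition has_radix (f : ram) :=
  [/\ has_base n b f, f 8 = K & f 11 = Posz (2 * T)].

Lemma extract_square_ok : triple G 6
  (fun f => [/\ has_params n b f & f 0 = q]) extract_square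
  (fun f => has_radix f /\
    [/\ f 0 = Posz (r * r), f 13 = P & f 5 = Posz (P * P)]).
Proof.
case: facts => -[h1 h2 h3 h4 h5] [h6 h7 h8].
apply: (@triple_block G [:: _; _; _; _; _; _]) => //.
move=> f [[B f8 f11 f12 f9] f0]; have [f1 f2 f3 f10 fb] := B.
have f12' : f 12 = P by [].
have hN : 0 < N by lia.
have e : q = q %/ (N + N) * (N + N) + r * r by rewrite -hqr -divn_eq.
have hd : q %/ (N + N) <= q by exact: leq_div.
have ed : (Posz q %/ Posz (N + N))%Z = Posz (q %/ (N + N)) by rewrite divz_nat.
move: e hd ed; move: (q %/ (N + N)) => d e hd ed.
wp_op (Posz (N + N)). simp_wp. exists (Posz d); split; first by rewrite f0.
split; first lia.
wp_op (Posz (d * (N + N))). wp_op (Posz (r * r)).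
wp_op (Posz P). simp_wp. exists (Posz (P * P)); split; first by rewrite f12'.
have -> : P * P = N by [].
split; first lia.
split=> //; split=> //.
by apply: has_base_glue B _ _ _ _ _.
Qed.

(** After [i] rounds [(x - r) * 2 ^ i <= P]. While the guard holds, [x - r >= 1], so [2 ^ i <= P];
    this bounds the number of rounds by the logarithm. *)
Lemma square_root_ok :
  triple G ((trunc_log 2 P).+1 * (5 + 2) + 2)
  (fun f => has_radix f /\
    [/\ f 0 = Posz (r * r), f 13 = P & f 5 = Posz (P * P)])
  square_root
  (fun f => has_radix f /\ f 13 = r).
Proof.
case: facts => -[h1 h2 h3 h4 h5] [h6 h7 h8].
pose I i f := exists x : nat, [/\ has_radix f, f 0 = Posz (r * r),
   f 13 = x /\ f 5 = Posz (x * x), r <= x <= P & (x - r) * 2 ^ i <= P].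
apply: (@triple_weaken G _ _ (I 0) _ _
    (fun f => exists i, I i f /\ ~~ (f 0 < f 5)%R)) (leqnn _) _.
- move=> f [Pf [f0 f13 f5]]; exists P.
  have hP : r <= P <= P by rewrite leqnn ltnW.
  have hP2 : (P - r) * 2 ^ 0 <= P by rewrite expn0 muln1 leq_subr.
  exact: And5 Pf f0 (conj f13 f5) hP hP2.
- move=> f [i [[x [Pf f0 [f13 f5] hx _]] hlt]]; split=> //.
  rewrite f13; congr Posz; move: hlt; rewrite f0 f5 ltz_nat !mulnn ltn_sqr.
  by case/andP: hx; lia.
apply: triple_while => //.
  move=> i f [x [Pf f0 [f13 f5] hx hx2]]; rewrite f0 f5 => hlt.
  have hxr : r < x by rewrite -ltn_sqr -!mulnn.
  rewrite ltnS; apply: trunc_log_max => //.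
  by apply: leq_trans hx2; rewrite leq_pmull //; lia.
move=> i _; apply: (@triple_block G [:: _; _; _; _; _]) => //.
move=> f [[x [Pf f0 [f13 f5] hx hx2]]]; rewrite f0 f5 => hlt.
have hxr : r < x by rewrite -ltn_sqr -!mulnn.
have [s1 s2] := heron_step r x hxr.
have hd : r * r %/ x <= r.
  apply: (@leq_trans (r * x %/ x)); last by rewrite mulnK //; lia.
  by rewrite leq_div2r // leq_mul2l ltnW ?orbT.
have ed : (Posz (r * r) %/ Posz x)%Z = Posz (r * r %/ x) by rewrite divz_nat.
move: s1 s2 hd ed; move: (r * r %/ x) => d s1 s2 hd ed.
have ex' : (Posz (x + d) %/ Posz 2)%Z = Posz ((x + d) %/ 2) by rewrite divz_nat.
move: s1 s2 ex'; move: ((x + d) %/ 2) => x' s1 s2 ex'.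
have hx' : x' * x' <= N.
  by have -> : N = P * P by []; rewrite leq_mul //; lia.
simp_wp. exists (Posz d); split; first by rewrite f0 f13.
split; first lia.
wp_op (Posz (x + d)). wp_const.
simp_wp. exists (Posz x'); split; first by [].
split; first lia.
wp_op (Posz (x' * x')).
exists x'; split=> //.
- have [B f8 f11] := Pf; split=> //.
  by apply: has_base_glue B _ _ _ _ _.
- lia.
apply: leq_trans hx2; rewrite expnS mulnA leq_mul2r s2 orbT //.
Qed.

Lemma partial_row_recr i j : partial_row i j.+1 = (partial_row i j + b (i * n + j)%N * y j)%R.
Proof. by rewrite /partial_row big_nat_recr. Qed.

Lemma term_le i j : i < n -> j < n -> `|(b (i * n + j)%N * y j)%R| <= Sn * T.
Proof.
move=> hi hj; rewrite abszM leq_mul ?hy //.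
by apply: entry_le; apply: row_entry_lt.
Qed.

Lemma partial_row_le i j : i < n -> j <= n -> `|partial_row i j| <= Sn * N.
Proof.
case: facts => -[h1 h2 h3 h4 h5] [h6 h7 h8].
move=> hi hj; suff : `|partial_row i j| <= j * (Sn * T).
  by move=> h; apply: (leq_trans h); rewrite leq_mul //; lia.
elim: j hj => [_|j IH hj]; first by rewrite /partial_row big_geq.
rewrite partial_row_recr.
by have := term_le i j hi hj; have := IH (ltnW hj); lia.
Qed.

Lemma digits_fromE j : j < n -> digits_from j = (y j + digits_from j.+1 * K%:Z)%R.
Proof.
move=> hj; rewrite /digits_from big_ltn // subnn expr0 mulr1; congr (_ + _)%R.
rewrite mulr_suml; apply: eq_big_nat => i hi.
by rewrite -mulrA -exprSr; congr (_ * _ ^+ _)%R; lia.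
Qed.

Lemma digits_from_div j : j < n ->
  ((digits_from j + Posz (2 * T)) %/ Posz K)%Z = digits_from j.+1.
Proof.
case: facts => -[h1 h2 h3 h4 h5] [h6 h7 h8].
move=> hj; rewrite digits_fromE //; have := hy j hj => hyj.
rewrite -addrA addrCA divzMDl; last lia.
(* [y j + 2 T] lies between [T] and [3 T], hence in [[0, K)] because [K = 4 T]. *)
by rewrite divz_small ?addr0 //; lia.
Qed.

(** Keeps register 13 within the memory bound. Removing a digit changes the number by at most
    [T <= P] before the division by [K >= 2], so the bound by [P] persists. *)
Lemma digits_from_le j : j <= n -> `|digits_from j| <= P.
Proof.
case: facts => -[h1 h2 h3 h4 h5] [h6 h7 h8].
elim: j => [_|j IH hj]; first by rewrite -hry; lia.
have := IH (ltnW hj); rewrite digits_fromE //; have := hy j hj.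
move: (digits_from j.+1) (y j) => d z hz hdz.
have hd : `|d| * K <= P + T.
  by have := abszM d K; move: hz hdz; move: (d * Posz K)%R => e; rewrite absz_nat; lia.
rewrite leqNgt; apply/negP => hP.
have : P.+1 * 2 <= `|d| * K by rewrite leq_mul //; lia.
by lia.
Qed.

Lemma add_column_ok j : j < n ->
  triple G (n * (7 + 2) + 2)
  (fun f => [/\ has_matrix (fun i => partial_row i j) f, f 4 = j,
     f 13 = digits_from j.+1, f 14 = y j &
     [/\ f 5 = Posz (Hb + j), f 6 = Posz (Hb + n * n) & f 15 = Posz (Hb + n * n + n)]])
  add_column
  (fun f => [/\ has_matrix (fun i => partial_row i j.+1) f, f 4 = j &
     f 13 = digits_from j.+1]).
Proof.
case: facts => -[h1 h2 h3 h4 h5] [h6 h7 h8] hj.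
pose I i f := [/\ has_matrix (fun i' => partial_row i' (if i' < i then j.+1 else j)) f,
     f 4 = j /\ i <= n,
     f 13 = digits_from j.+1, f 14 = y j &
     [/\ f 5 = Posz (Hb + i * n + j), f 6 = Posz (Hb + n * n + i)
     & f 15 = Posz (Hb + n * n + n)]].
apply: (@triple_weaken G _ _ (I 0) _ _
    (fun f => exists i, I i f /\ ~~ (f 6 < f 15)%R)) (leqnn _) _.
- move=> f [Mf f4 f13 f14 [f5 f6 f15]]; split=> //; split=> //.
  by rewrite f5 addn0.
  by rewrite f6 addn0.
- move=> f [i [[[Rf f8 f11 fb fv] [f4 hi] f13 f14 [f5 f6 f15]] hlt]].
  split=> //; split=> // i' hi'; rewrite fv // ifT //.
  by move: hlt; rewrite f6 f15; lia.
apply: triple_while => //.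
  by move=> i f [_ [_ hi] _ _ [_ f6 f15]]; rewrite f6 f15; lia.
move=> i hi; apply: (@triple_block G [:: _; _; _; _; _; _; _]) => //.
move=> f [[[[f1 f2 f3 f9] f8 f11 fb fv] [f4 _] f13 f14 [f5 f6 f15]] _].
have hk := row_entry_lt n i j hi hj.
have bi : f (Hb + i * n + j) = b (i * n + j) by rewrite -addnA fb.
have vi : f (Hb + n * n + i) = partial_row i j by rewrite fv // ltnn.
have ht := term_le i j hi hj.
have hp := partial_row_le i j.+1 hi hj.
wp_load (Hb + i * n + j). rewrite glue_heap; last lia. rewrite bi.
simp_wp. exists (b (i * n + j)%N * y j)%R; split; first by rewrite f14.
split; first lia.
wp_load (Hb + n * n + i). rewrite glue_heap; last lia. rewrite vi.
simp_wp. exists (partial_row i j.+1); split; first by rewrite partial_row_recr.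
split; first lia.
wp_store (Hb + n * n + i).
wp_op (Posz (Hb + i.+1 * n + j)). wp_op (Posz (Hb + n * n + i.+1)).
split=> //=; split=> //=.
- move=> k hk'; rewrite glue_heap; last lia.
  by rewrite /upd ifF ?fb //; lia.
move=> i' hi'; rewrite glue_heap; last lia.
rewrite /upd; case: eqP => hne.
  by rewrite (_ : i' = i) ?ltnSn //; lia.
by rewrite fv // (_ : (i' < i.+1) = (i' < i)) //; lia.
Qed.

Lemma decode_digits_ok :
  triple G (2 + (n * ((8 + (n * (7 + 2) + 2 + 1)) + 2) + 2))
  (fun f => has_radix f /\ f 13 = r) decode_digits
  (has_matrix (fun i => partial_row i n)).
Proof.
case: facts => -[h1 h2 h3 h4 h5] [h6 h7 h8].
pose I j f := [/\ has_matrix (fun i => partial_row i j) f, f 4 = Posz j,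
   j <= n & f 13 = digits_from j].
apply: (@triple_seq G 2 _ _ (I 0)).
  apply: (@triple_block G [:: _; _]) => // f [[B f8 f11] f13].
  have [f1 f2 f3 f10 fb] := B.
  have f3' : f 3 = Hb by [].
  wp_op (Posz (Hb + n * n)). wp_const.
  split=> //=; last by rewrite /glue /= f13.
  split=> //.
    by move=> k hk; rewrite glue_heap ?fb //; lia.
  move=> i hi; rewrite glue_heap; last lia.
  rewrite -addnA fb; last lia.
  rewrite /partial_row big_geq //.
  by rewrite hb0 //; lia.
apply: (@triple_weaken G _ _ (I 0) _ _
    (fun f => exists i, I i f /\ ~~ (f 4 < f 2)%R)) (leqnn _) _ => //.
- move=> f [j [[Mf f4 hj f13] hlt]]; have [[_ f2 _ _] _ _ _ _] := Mf.
  by have -> : n = j by move: hlt; rewrite f4 f2; lia.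
apply: triple_while => //.
  move=> j f [Mf f4 hj f13] hlt; have [[_ f2 _ _] _ _ _ _] := Mf.
  by move: hlt; rewrite f4 f2; lia.
move=> j hj.
apply: (@triple_seq G 8 _ _ _ _ _ _ _ (triple_seq (add_column_ok j hj) _)).
  apply: (@triple_block G [:: _; _; _; _; _; _; _; _]) => //.
  move=> f [[[[f1 f2 f3 f9] f8 f11 fb fv] f4 _ f13] _].
  have hd := digits_from_le j (ltnW hj).
  have hd1 := digits_from_le j.+1 hj.
  have hdE := digits_fromE j hj.
  have hyj := hy j hj.
  wp_op (digits_from j + Posz (2 * T))%R.
  simp_wp. exists (digits_from j.+1); split; first by rewrite f8 digits_from_div.
  split; first lia.
  simp_wp. exists (digits_from j.+1 * K)%R; split; first by rewrite f8.
  split; first lia.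
  wp_op (y j). wp_op (digits_from j.+1). wp_op (Posz (Hb + j)).
  wp_op (Posz (Hb + n * n)). wp_op (Posz (Hb + n * n + n)).
  split=> //=; split=> //=.
  - by move=> k hk; rewrite glue_heap ?fb //; lia.
  by move=> i hi; rewrite glue_heap ?fv //; lia.
apply: (@triple_block G [:: _]) => //.
move=> f [[[f1 f2 f3 f9] f8 f11 fb fv] f4 f13].
wp_op (Posz j.+1).
split=> //=; split=> //=.
- by move=> k hk; rewrite glue_heap ?fb //; lia.
by move=> i hi; rewrite glue_heap ?fv //; lia.
Qed.

Lemma copy_output_ok (v : nat -> int) :
  triple G (1 + (n * (5 + 2) + 2 + (2 + (14 * 2 + 1))))
  (has_matrix v) copy_output (fun f => forall j, j < n -> f j.+1 = v j).
Proof.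
case: facts => -[h1 h2 h3 h4 h5] [h6 h7 h8].
pose R (f : ram) := [/\ f 1 = 1, f 2 = n, f 9 = Posz (Hb + n * n) &
   forall i, i < n -> f (Hb + n * n + i) = v i].
pose I i f := [/\ R f, f 4 = Posz (15 + i) &
   forall j, 15 <= j < n -> j < 15 + i -> f j.+1 = v j].
apply: (@triple_seq G 1 _ _ (I 0)).
  apply: (@triple_block G [:: _]) => // f [[f1 f2 f3 f9] f8 f11 fb fv].
  wp_const. split=> //=; last lia.
  by split=> // i hi; rewrite glue_heap ?fv //; lia.
apply: (@triple_seq G _ _ _ (fun f => R f /\ forall j, 15 <= j < n -> f j.+1 = v j)).
  apply: (@triple_weaken G (n * (5 + 2) + 2) _ (I 0) _ _
    (fun f => exists i, I i f /\ ~~ (f 4 < f 2)%R)) => //.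
    move=> f [i [[Rf f4 fo] hlt]]; split=> // j hj; apply: fo => //.
    by have [_ f2 _ _] := Rf; move: hlt; rewrite f4 f2; lia.
  apply: triple_while => //.
    move=> i f [[_ f2 _ _] f4 _] hlt.
    by move: hlt; rewrite f4 f2; lia.
  move=> i hi; apply: (@triple_block G [:: _; _; _; _; _]) => //.
  move=> f [[[f1 f2 f9 fv] f4 fo] hlt].
  have {}hlt : 15 + i < n by move: hlt; rewrite f4 f2; lia.
  wp_op (Posz (Hb + n * n + (15 + i))). wp_load (Hb + n * n + (15 + i)).
  wp_op (Posz (15 + i).+1). wp_store (15 + i).+1. wp_op (Posz (15 + i.+1)).
  split=> //=.
    split=> // i' hi'; rewrite glue_heap; last lia.
    (* Output cells go up to [n <= n^2], so none of them overwrites the accumulator. *)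
    have hnn : n <= n * n by rewrite leq_pmulr //; lia.
    by rewrite /upd ifF ?fv //; lia.
  move=> j hj hji; rewrite glue_heap; last lia.
  rewrite /upd; case: eqP => hne.
    rewrite glue_heap; last lia. by rewrite fv //; congr v; lia.
  by apply: fo; lia.
(* Cell 15 receives coordinate 14, where the pointer starts. For [n < 15] the cells above [n] get
   whatever follows the accumulator, so only [j < n] is claimed. *)
pose J i (f : ram) := [/\ f 1 = 1, f 0 = Posz (Hb + n * n + (14 - i)),
   forall i, i < n -> f (Hb + n * n + i) = v i &
   forall j, 15 - i <= j < n -> f j.+1 = v j].
apply: (@triple_seq G 2 _ _ (J 0)).
  apply: (@triple_block G [:: _; _]) => // f [[f1 f2 f9 fv] fo].
  wp_const. wp_op (Posz (Hb + n * n + 14)).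
  split=> //=.
    by move=> i hi; rewrite glue_heap ?fv //; lia.
  by move=> j hj; rewrite glue_heap ?fo //; lia.
apply: (@triple_seq G _ _ _ (J 14)); last first.
  apply: (@triple_block G [:: _]) => // f [f1 f0 fv fo].
  wp_load (Hb + n * n). rewrite glueK => -[|j] hj.
    by rewrite /glue /= -(fv 0 hj) addn0.
  rewrite -(fo j.+1); last lia.
  by rewrite /glue; case: ifP.
apply: (@triple_seqs G 2 14 J) => i hi.
apply: (@triple_block G [:: _; _]).
  by rewrite /=; lia.
move=> f [f1 f0 fv fo].
have e0 : (0 == 15 - i) = false by lia.
have e1 : (1 == 15 - i) = false by lia.
wp_load (Hb + n * n + (14 - i)).
simp_wp. rewrite e0 e1 f0 f1. exists (Posz (Hb + n * n + (14 - i.+1))).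
split; first lia. split; first lia.
split=> //=.
- by rewrite /glue /= e1.
- by move=> k hk; rewrite glue_heap ?fv //; lia.
move=> j hj; case: (ltnP j 15) => hj15; last first.
  by rewrite glue_heap ?fo //; lia.
rewrite {1}/glue ifT //.
case: eqP => hne.
  rewrite glue_heap; last lia. by rewrite fv; [congr v|]; lia.
by apply: fo; lia.
Qed.

End Decoding.

(** * Shortest vectors of the perturbed lattice *)

Section IntegerVectors.

Definition sqnorm n (v : 'cV[int]_n) : int := \sum_i v i 0 ^+ 2.
Definition norm1 n (v : 'cV[int]_n) : int := \sum_i `|v i 0|.

Lemma sqnorm_ge0 n (v : 'cV[int]_n) : 0 <= sqnorm n v.
Proof. by apply: sumr_ge0 => i _; apply: sqr_ge0. Qed.

Lemma norm1_ge0 n (v : 'cV[int]_n) : 0 <= norm1 n v.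
Proof. by apply: sumr_ge0. Qed.

Lemma sqnorm_eq0 n (v : 'cV[int]_n) : sqnorm n v = 0 -> v = 0.
Proof.
move=> h; apply/colP => i; rewrite mxE.
have /eqP : v i 0 ^+ 2 = 0 by apply: (psumr_eq0P (fun j _ => sqr_ge0 (v j 0)) h).
by rewrite sqrf_eq0 => /eqP.
Qed.

Lemma sqnormN n (v : 'cV[int]_n) : sqnorm n (- v) = sqnorm n v.
Proof. by apply: eq_bigr => i _; rewrite mxE sqrrN. Qed.

Lemma entry_sqr_le n (v : 'cV[int]_n) i : v i 0 ^+ 2 <= sqnorm n v.
Proof.
rewrite /sqnorm (bigD1 i) //= lerDl.
by apply: sumr_ge0 => j _; apply: sqr_ge0.
Qed.

Lemma entry_mul_le n (v : 'cV[int]_n) i j : `|v i 0| * `|v j 0| <= sqnorm n v.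
Proof.
case: (lerP `|v i 0| `|v j 0|) => h.
  apply: le_trans (entry_sqr_le _ v j); rewrite -[v j 0 ^+ 2]real_normK ?num_real //.
  by rewrite expr2 ler_wpM2r.
apply: le_trans (entry_sqr_le _ v i); rewrite -[v i 0 ^+ 2]real_normK ?num_real //.
by rewrite expr2 ler_wpM2l // ltW.
Qed.

Lemma entry_norm1_le n (v : 'cV[int]_n) i : `|v i 0| * norm1 n v <= n%:R * sqnorm n v.
Proof.
rewrite mulr_sumr mulr_natl.
apply: (@le_trans _ _ (\sum_(j < n) sqnorm n v)).
  by apply: ler_sum => j _; apply: entry_mul_le.
by rewrite sumr_const card_ord.
Qed.

(** A crude Cauchy-Schwarz inequality: each of the [n ^ 2] products is bounded by the squared norm.
    The extra factor [n] is absorbed by [D] later. *)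
Lemma norm1_sqr_le n (v : 'cV[int]_n) :
  norm1 n v ^+ 2 <= n%:R ^+ 2 * sqnorm n v.
Proof.
rewrite expr2 {1}/norm1 mulr_suml.
apply: (@le_trans _ _ (\sum_(j < n) (n%:R * sqnorm n v))).
  by apply: ler_sum => j _; apply: entry_norm1_le.
by rewrite sumr_const card_ord -[_ *+ n]mulr_natl mulrA expr2.
Qed.

Lemma norm1_le_sqnorm n (v : 'cV[int]_n) : norm1 n v <= sqnorm n v.
Proof.
apply: ler_sum => i _; rewrite -[v i 0 ^+ 2]real_normK ?num_real //.
by move: (`|v i 0|) (normr_ge0 (v i 0)) => z hz; nia.
Qed.

(** Laplace expansion along the first row: minors inherit the hypothesis, since deleting a column
    only lowers the row sums. This replaces Hadamard's inequality. *)
Lemma det_norm_le m (A : 'M[int]_m) (s : int) :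
  (forall i, \sum_j `|A i j| <= s) -> `|\det A| <= s ^+ m.
Proof.
elim: m A => [|m IH] A hA; first by rewrite det_mx00 normr1.
have s0 : 0 <= s by apply: le_trans (hA ord0); apply: sumr_ge0.
rewrite (expand_det_row A ord0).
apply: (le_trans (ler_norm_sum _ _ _)).
apply: (@le_trans _ _ (\sum_j (`|A ord0 j| * s ^+ m))); last first.
  by rewrite -mulr_suml exprS ler_wpM2r ?exprn_ge0.
apply: ler_sum => j _; rewrite normrM ler_wpM2l // /cofactor normrM.
rewrite normrX normrN1 expr1n mul1r; apply: IH => i.
apply: le_trans (hA (lift ord0 i)); rewrite (bigD1_ord j) //=.
rewrite -[X in X <= _]add0r lerD //.
by apply: ler_sum => k _; rewrite !mxE.
Qed.

(** The minors have size one less; [1 <= s] allows the uniform exponent [n]. *)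
Lemma adj_norm_le n (A : 'M[int]_n) (s : int) i j :
  1 <= s -> (forall i, \sum_j `|A i j| <= s) -> `|(\adj A) i j| <= s ^+ n.
Proof.
case: n A i j => [|n] A i j hs hA; first by case: i.
rewrite mxE /cofactor normrM normrX normrN1 expr1n mul1r.
apply: (@le_trans _ _ (s ^+ n)); last by rewrite ler_weXn2l.
apply: det_norm_le => k; apply: le_trans (hA (lift j k)).
rewrite [X in _ <= X](bigD1_ord i) //=.
rewrite -[X in X <= _]add0r lerD //.
by apply: ler_sum => l _; rewrite !mxE.
Qed.

(* Cramer's rule; an integer determinant that is not zero has absolute value at least 1. *)
Lemma preimage_norm_le n (A : 'M[int]_n) (s : int) (y : 'cV[int]_n) i :
  1 <= s -> (forall i, \sum_j `|A i j| <= s) -> \det A != 0 ->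
  `|y i 0| <= s ^+ n * norm1 n (A *m y).
Proof.
move=> hs hA hdet.
have E : \det A * y i 0 = \sum_j (\adj A) i j * (A *m y) j 0.
  have := congr1 (fun M : 'cV_n => M i 0) (mulmxA (\adj A) A y).
  by rewrite mul_adj_mx mul_scalar_mx !mxE => <-.
apply: (@le_trans _ _ `|\det A * y i 0|).
  have : 0 < `|\det A| by rewrite normr_gt0.
  by rewrite normrM => hd; rewrite ler_peMl //; lia.
rewrite E; apply: (le_trans (ler_norm_sum _ _ _)).
rewrite mulr_sumr; apply: ler_sum => j _.
by rewrite normrM ler_wpM2r // adj_norm_le.
Qed.

End IntegerVectors.

(** * Effect of the perturbation on squared lengths, in positive dimension *)

Section Perturbation.
Variables (m : nat).
Local Notation n := m.+1.
Variables (B : 'M[int]_n) (S K : int).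
Hypothesis hdet : \det B != 0.
Hypothesis hSn : n%:Z < S.
Hypothesis hrow : forall i, \sum_j `|B i j| <= S.
Hypothesis hcol : sqnorm _ (col ord0 B) <= S.
Hypothesis hK : K = 4 * S ^+ n.+1.

Definition offset (y : 'cV[int]_n) : int := \sum_(j < n) K ^+ j * y j 0.

Definition perturbed (N : int) : 'M[int]_n :=
  \matrix_(i < n, j < n) (B i j * N + (if i == ord0 then K ^+ j else 0)).

Lemma offsetN y : offset (- y) = - offset y.
Proof. by rewrite -sumrN; apply: eq_bigr => j _; rewrite mxE mulrN. Qed.

Lemma perturbed_mul N y : perturbed N *m y =
  N *: (B *m y) + offset y *: delta_mx ord0 0.
Proof.
apply/colP => i; rewrite !mxE eqxx andbT mulr_sumr mulr_suml -big_split /=.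
apply: eq_bigr => j _; rewrite !mxE mulrDl.
by case: eqP => _; rewrite ?mulr1 ?mulr0 ?mul0r; ring.
Qed.

Lemma sqnorm_perturbed N y : sqnorm _ (perturbed N *m y) =
  N ^+ 2 * sqnorm _ (B *m y) + 2 * N * ((B *m y) ord0 0 * offset y) + offset y ^+ 2.
Proof.
rewrite perturbed_mul; move: (B *m y) (offset y) => v s.
rewrite /sqnorm (bigD1 ord0) //= [X in _ = _ * X + _ + _](bigD1 ord0) //=.
rewrite !mxE !eqxx /= mulr1.
rewrite (eq_bigr (fun i => N ^+ 2 * v i 0 ^+ 2)); last first.
  by move=> i hi; rewrite !mxE (negbTE hi) mulr0 addr0 exprMn.
by rewrite -mulr_sumr; move: (\sum_(i < _ | _) _) => a; ring.
Qed.

Let S1 : 1 <= S. Proof. by move: hSn; lia. Qed.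
Let T := S ^+ n.+1.
Let T1 : 1 <= T. Proof. by rewrite exprn_ege1. Qed.
Let K4 : 4 <= K. Proof. by rewrite hK; move: T1; rewrite /T; lia. Qed.

Lemma geometric_lt (k : nat) : \sum_(j < k) K ^+ j <= K ^+ k.
Proof.
elim: k => [|k IH]; first by rewrite big_ord0.
have hz : 0 <= K ^+ k by apply: exprn_ge0; lia.
have h4 := ler_wpM2r hz K4; rewrite big_ord_recr /= exprS.
apply: (@le_trans _ _ (K ^+ k + K ^+ k)); first by rewrite lerD2r.
by move: (K ^+ k) (K * K ^+ k) h4 hz => z z' h4 hz; lia.
Qed.

(** The bound is relative to [B y], hence usable for arbitrarily long competitors. *)
Lemma offset_le y : `|offset y| <= K ^+ n * (S ^+ n * norm1 _ (B *m y)).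
Proof.
have K0 : 0 <= K by lia.
apply: (le_trans (ler_norm_sum _ _ _)).
apply: (@le_trans _ _ (\sum_(j < n) K ^+ j * (S ^+ n * norm1 _ (B *m y)))).
  apply: ler_sum => j _; rewrite normrM ger0_norm ?exprn_ge0 //.
  by rewrite ler_wpM2l ?exprn_ge0 //; apply: preimage_norm_le.
rewrite -mulr_suml ler_wpM2r ?geometric_lt //.
by rewrite mulr_ge0 ?norm1_ge0 // exprn_ge0 //; lia.
Qed.

(** Relative size of the disturbance: with [v = B y] and [s] the offset, [2 |v_0 s| <= D |v|^2] and
    [s^2 <= D^2 |v|^2]. *)
Let D : int := 2 * n%:R * (K ^+ n * S ^+ n).

Let D0 : 0 <= D.
Proof. by rewrite /D !mulr_ge0 ?exprn_ge0 //; lia. Qed.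

Lemma sqnorm_perturbed_bounds N y : 0 <= N ->
  N * (N - D) * sqnorm _ (B *m y) <= sqnorm _ (perturbed N *m y)
    <= (N ^+ 2 + N * D + D ^+ 2) * sqnorm _ (B *m y).
Proof.
move=> N0; rewrite sqnorm_perturbed.
have ho := offset_le y; have hd := D0.
have h1 := entry_norm1_le _ (B *m y) ord0.
have h2 := norm1_sqr_le _ (B *m y).
have q0 := sqnorm_ge0 _ (B *m y).
have l0 := norm1_ge0 _ (B *m y).
have W0 : 0 <= K ^+ n * S ^+ n by rewrite mulr_ge0 ?exprn_ge0 //; lia.
move: ho; rewrite mulrA /D.
move: (K ^+ n * S ^+ n) W0 (offset y) h1 h2 q0 l0 => W W0 s.
move: (sqnorm _ _) (norm1 _ _) (fun_of_matrix (B *m y) ord0 0) => Q L v h1 h2 Q0 L0 ho.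
have n0 : 0 <= n%:R :> int by [].
move: (n%:R : int) n0 h1 h2 => k k0 h1 h2.
have hv : `|v * s| <= W * (k * Q).
  rewrite normrM; apply: (@le_trans _ _ (W * (`|v| * L))).
    by rewrite mulrCA ler_wpM2l.
  by rewrite ler_wpM2l.
have hs : s ^+ 2 <= W ^+ 2 * (k ^+ 2 * Q).
  apply: (@le_trans _ _ (W ^+ 2 * L ^+ 2)); last by rewrite ler_wpM2l ?exprn_ge0.
  by rewrite -exprMn -[s ^+ 2]real_normK ?num_real // lerXn2r ?nnegrE ?mulr_ge0.
have hs0 : 0 <= s ^+ 2 by apply: sqr_ge0.
have hWQ : 0 <= W ^+ 2 * (k ^+ 2 * Q) by rewrite !mulr_ge0 ?exprn_ge0.
move: hv; rewrite ler_norml => /andP[hv1 hv2].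
have a1 := ler_wpM2l N0 hv1; have a2 := ler_wpM2l N0 hv2.
by apply/andP; split; nra.
Qed.

Let P := K ^+ n.+1.
Let N := P * P.

(** The threshold that [shortest_perturbed] requires. Replacing [1 + 3 S] by [4 S] completes the
    factor [S ^ n] of [D] to [K], which leaves [2 n K ^ n.+1], and [2 n < K <= P]. *)
Lemma scale_gt : D * (1 + 3 * S) < N.
Proof.
have K0 : 0 <= K by lia.
have e : D * (1 + 3 * S) <= 2 * n%:R * K ^+ n.+1.
  have eK : K = 4 * (S ^+ n * S) by rewrite hK exprSr.
  have -> : 2 * n%:R * K ^+ n.+1 = D * (4 * S).
    by rewrite exprSr {2}eK /D; ring.
  by rewrite ler_wpM2l ?D0 //; lia.
apply: (le_lt_trans e); rewrite /N ltr_pM2r; last by rewrite exprn_gt0 //; lia.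
apply: (@lt_le_trans _ _ K).
  rewrite hK; have : S <= S ^+ n.+1 by rewrite ler_eXnr.
  by rewrite natz; move: hSn; lia.
by rewrite /P ler_eXnr //; lia.
Qed.

Let N0 : 0 <= N. Proof. by rewrite /N -expr2 sqr_ge0. Qed.

Let DN : D < N.
Proof. by apply: le_lt_trans scale_gt; rewrite ler_peMr //; lia. Qed.

(** A kernel vector [u] would satisfy [N (N - D) |B u|^2 <= 0], hence lie in the kernel of [B]. The
    transposes are due to [det0P] speaking of row vectors. *)
Lemma perturbed_det : \det (perturbed N) != 0.
Proof.
apply/negP; rewrite -det_tr => /det0P [u hu hu0].
have e : perturbed N *m u^T = 0.
  by rewrite -[perturbed N]trmxK -trmx_mul hu0 trmx0.
have /andP[h _] := sqnorm_perturbed_bounds N u^T N0.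
move: h; rewrite e (_ : sqnorm _ 0 = 0); last first.
  by apply: big1 => i _; rewrite mxE expr0n.
have hq := sqnorm_ge0 _ (B *m u^T).
have hp : 0 < N * (N - D) by rewrite mulr_gt0 ?subr_gt0 // (le_lt_trans D0 DN).
rewrite pmulr_rle0 // => hq2.
have /sqnorm_eq0 hBu : sqnorm _ (B *m u^T) = 0 by apply/eqP; rewrite eq_le hq2.
move: hdet; apply/negP; rewrite negbK -det_tr; apply/det0P; exists u => //.
by apply: trmx_inj; rewrite trmx_mul trmxK hBu trmx0.
Qed.

Definition shortest (A : 'M[int]_n) (y : 'cV[int]_n) :=
  y != 0 /\ forall z, z != 0 -> sqnorm _ (A *m y) <= sqnorm _ (A *m z).

Lemma shortest_exists (A : 'M[int]_n) : exists y, shortest A y.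
Proof.
pose p k := `[< exists y : 'cV[int]_n, y != 0 /\ sqnorm _ (A *m y) = Posz k >].
have hp : exists k, p k.
  exists (absz (sqnorm _ (A *m delta_mx ord0 0))); apply/asboolP; exists (delta_mx ord0 0).
  split; last by rewrite gez0_abs ?sqnorm_ge0.
  by apply/eqP => /matrixP /(_ ord0 ord0) /eqP; rewrite !mxE !eqxx /= oner_eq0.
case: (ex_minnP hp) => k /asboolP[y [hy hk]] hmin; exists y; split=> // z hz.
rewrite hk -[sqnorm _ _]gez0_abs ?sqnorm_ge0 // lez_nat.
by apply: hmin; apply/asboolP; exists z; split=> //; rewrite gez0_abs ?sqnorm_ge0.
Qed.

Lemma shortestN A y : shortest A y -> shortest A (- y).
Proof. by move=> [hy h]; split; rewrite ?oppr_eq0 // mulmxN sqnormN. Qed.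

(** The competitor is the first column of [B]. *)
Lemma shortest_le y : shortest B y -> sqnorm _ (B *m y) <= S.
Proof.
move=> [_ h]; apply: le_trans hcol; rewrite colE; apply: h.
by apply/eqP => /matrixP /(_ ord0 ord0) /eqP; rewrite !mxE !eqxx /= oner_eq0.
Qed.

(** Let [l] be the minimum for [B]. If [B y] were longer, its squared length would be at least
    [l + 1] by integrality, so [N (N - D) (l + 1) <= (N^2 + N D + D^2) l]. Using [D <= N] this
    becomes [N <= D (1 + 3 l)], against [scale_gt] and [l <= S]. *)
Lemma shortest_perturbed y : shortest (perturbed N) y -> shortest B y.
Proof.
move=> [hy hmin]; split=> // z hz.
have [x hx] := shortest_exists B; have [hx0 hxmin] := hx.
apply: le_trans (hxmin z hz).
have lam := shortest_le x hx.
have lam0 := sqnorm_ge0 _ (B *m x).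
have /andP[h1 _] := sqnorm_perturbed_bounds N y N0.
have /andP[_ h2] := sqnorm_perturbed_bounds N x N0.
have h3 := hmin x hx0.
have h := le_trans h1 (le_trans h3 h2).
rewrite leNgt; apply/negP => hlt.
have hlt1 : sqnorm _ (B *m x) + 1 <= sqnorm _ (B *m y) by rewrite lezD1.
move: (sqnorm _ (B *m x)) (sqnorm _ (B *m y)) lam lam0 h hlt1 => l q lam lam0 h hlt1.
have g := scale_gt; have d0 := D0; have dn := DN; have n0 := N0.
move: N D g d0 dn n0 h => M E g d0 dn n0 h.
have h4 : M * (M - E) * (l + 1) <= (M ^+ 2 + M * E + E ^+ 2) * l.
  by apply: le_trans h; rewrite ler_wpM2l // mulr_ge0 //; lia.
have h5 : E ^+ 2 * l <= M * E * l by rewrite expr2 ler_wpM2r // ler_wpM2r //; lia.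
have h6 : M * M <= M * (E * (1 + 3 * l)).
  by move: h4 h5; rewrite !expr2; lia.
have M0 : 0 < M by lia.
move: h6; rewrite ler_pM2l // => h6.
have h7 : E * (1 + 3 * l) <= E * (1 + 3 * S) by rewrite ler_wpM2l //; lia.
by lia.
Qed.

(** Cramer gives [S ^ n] times the l1 norm of [B y], which is at most its squared norm, hence at
    most [S]: this is the exponent [n.+1] of [T]. *)
Lemma shortest_entry_le y i : shortest B y -> `|y i 0| <= T.
Proof.
move=> hy; apply: le_trans (preimage_norm_le _ B S y i S1 hrow hdet) _.
rewrite /T (exprSr S n) ler_wpM2l ?exprn_ge0 //; first by lia.
exact: le_trans (norm1_le_sqnorm _ _) (shortest_le y hy).
Qed.

Lemma shortest_offset_lt y : shortest B y -> `|offset y| < P.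
Proof.
move=> hy; apply: (le_lt_trans (offset_le y)).
have Kn : 0 < K ^+ n by rewrite exprn_gt0 //; lia.
rewrite /P (exprSr K n) ltr_pM2l //.
apply: (@le_lt_trans _ _ T); last by rewrite hK; move: T1; rewrite /T; lia.
rewrite /T (exprSr S n) ler_wpM2l ?exprn_ge0 //; first by lia.
exact: le_trans (norm1_le_sqnorm _ _) (shortest_le y hy).
Qed.

Lemma sqnorm_perturbed_mod y : shortest B y ->
  (sqnorm _ (perturbed N *m y) %% (N + N))%Z = offset y ^+ 2.
Proof.
move=> hy; have ho := shortest_offset_lt y hy.
have hs : offset y ^+ 2 < N.
  rewrite /N -expr2 -[offset y ^+ 2]real_normK ?num_real //.
  by rewrite ltrXn2r ?nnegrE // ltW // (le_lt_trans _ ho).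
rewrite sqnorm_perturbed.
(* One factor [K = 4 S ^ n.+1] of [N] yields the 2; the half of [N] is then the quotient of [N ^ 2]
   by [2 N]. *)
have eN : N = 2 * (2 * S ^+ n.+1 * K ^+ n * P).
  by rewrite /N {1}/P exprS hK; ring.
have -> : N ^+ 2 * sqnorm _ (B *m y) + 2 * N * ((B *m y) ord0 0 * offset y)
   + offset y ^+ 2 = ((2 * S ^+ n.+1 * K ^+ n * P) * sqnorm _ (B *m y)
      + (B *m y) ord0 0 * offset y) * (N + N) + offset y ^+ 2.
  rewrite expr2 {1}eN; ring.
rewrite modzMDl modz_small //; move: N0 hs (sqr_ge0 (offset y)); lia.
Qed.

(** Bounds the oracle's answer, which enters memory and so affects the cost of instructions. *)
Lemma sqnorm_perturbed_le y : shortest (perturbed N) y ->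
  sqnorm _ (perturbed N *m y) <= 3 * (S * (N * N)).
Proof.
move=> /shortest_perturbed hy.
have /andP[_ h] := sqnorm_perturbed_bounds N y N0.
apply: (le_trans h); have l := shortest_le y hy; have l0 := sqnorm_ge0 _ (B *m y).
move: (sqnorm _ _) l l0 {h} => l lS l0; have d0 := D0; have dn := DN; have n0 := N0.
move: N D d0 dn n0 => M E d0 dn n0.
have h1 : M * E <= M * M by rewrite ler_wpM2l // ltW.
have h2 : E * E <= M * M by rewrite ler_pM // ltW.
apply: (@le_trans _ _ (3 * (M * M) * l)).
  by rewrite ler_wpM2r // !expr2; lia.
rewrite [X in _ <= X](_ : _ = 3 * (M * M) * S); last ring.
by rewrite ler_wpM2l // mulr_ge0 // mulr_ge0.
Qed.

End Perturbation.

(** * Correctness and cost of the reduction *)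

Section Lambda.

Lemma vnorm_mxR n (v : 'cV[int]_n) :
  vnorm (mxR v) = Num.sqrt (sqnorm n v)%:~R.
Proof.
rewrite /vnorm /sqnorm rmorph_sum /=; congr Num.sqrt.
by apply: eq_bigr => i _; rewrite mxE rmorphXn.
Qed.

Lemma mxR_mul n (A : 'M[int]_n) (y : 'cV[int]_n) :
  mxR (A *m y) = mxR A *m map_mx (fun z : int => z%:~R) y.
Proof. exact: map_mxM. Qed.

Lemma mxR_eq0 n (v : 'cV[int]_n) : (mxR v == 0) = (v == 0).
Proof.
apply/eqP/eqP => [h|->]; last by apply/matrixP => i j; rewrite !mxE.
apply/matrixP => i j; move/matrixP: h => /(_ i j); rewrite !mxE => /eqP.
by rewrite intr_eq0 => /eqP.
Qed.

(** [shortest] speaks of nonzero coordinates, [lambda1] of nonzero vectors; nonsingularity makes the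
    two agree, and the infimum is attained. *)
Lemma lambda1_shortest m (A : 'M[int]_m.+1) y : \det A != 0 -> shortest m A y ->
  lambda1 (mxR A) = vnorm (mxR (A *m y)).
Proof.
move=> hdet [hy hmin]; rewrite /lambda1; set E := image _ _.
have Ay z : z != 0 -> A *m z != 0.
  apply: contraNneq => h; move: (mulmxA (\adj A) A z).
  rewrite h mulmx0 mul_adj_mx mul_scalar_mx => /esym/eqP.
  by rewrite scalemx_eq0 (negbTE hdet).
have hE : E (vnorm (mxR (A *m y))).
  exists (mxR (A *m y)) => //; split; last by rewrite mxR_eq0 Ay.
  by exists y; rewrite mxR_mul.
have hlb : lbound E (vnorm (mxR (A *m y))).
  move=> _ [w [[z ->] hw] <-]; rewrite -mxR_mul !vnorm_mxR.
  rewrite ler_wsqrtr // ler_int; apply: hmin.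
  by apply: contraNneq hw => ->; rewrite -mxR_mul mulmx0 mxR_eq0.
apply/eqP; rewrite eq_le; apply/andP; split.
  by apply: ge_inf => //; exists (vnorm (mxR (A *m y))).
by apply: lb_le_inf => //; exists (vnorm (mxR (A *m y))).
Qed.

(** There is no nonzero vector in dimension 0, and [inf] of the empty set is 0 by convention. *)
Lemma lambda1_mx00 (A : 'M[int]_0) : lambda1 (mxR A) = 0.
Proof.
rewrite /lambda1; set E := image _ _; suff -> : E = set0 by rewrite inf0.
rewrite -subset0 => x [v [_ hv]] _; move: hv.
by rewrite (flatmx0 v) eqxx.
Qed.

End Lambda.

(** * From memory contents to matrices, and what the oracle's answer encodes *)

Section Reduction.

Lemma Posz_exp (a k : nat) : Posz (a ^ k)%N = a%:Z ^+ k.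
Proof. by rewrite -[LHS]natz natrX natz. Qed.

Definition entries n (B : 'M[int]_n) : nat -> int := fun k => init_mem B k.+1.

Lemma input_at_init n (B : 'M[int]_n) : input_at n (entries n B) (init_mem B).
Proof. by case. Qed.

Lemma entries0 n (B : 'M[int]_n) k : (n * n <= k)%N -> entries n B k = 0.
Proof. by move=> h; rewrite /entries /init_mem /= ltnNge h. Qed.

Lemma entriesE n (B : 'M[int]_n) (i j : 'I_n) : entries n B (i * n + j)%N = B i j.
Proof.
have hj := ltn_ord j; have hi := ltn_ord i.
have n0 : (0 < n)%N by apply: leq_ltn_trans hj.
rewrite /entries /init_mem /= row_entry_lt //.
have e1 : ((i * n + j) %/ n)%N = i by rewrite divnMDl // divn_small // addn0.
have e2 : ((i * n + j) %% n)%N = j by rewrite modnMDl modn_small.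
case: eqP => [h1|]; last by rewrite e1 hi.
case: eqP => [h2|]; last by rewrite e2 hj.
by congr (B _ _); apply: val_inj; rewrite /= ?e1 ?e2.
Qed.

Lemma norm_boundE n (B : 'M[int]_n) : Posz (norm_bound n (entries n B)) =
  n.+1%:Z + \sum_i \sum_j (B i j) ^+ 2.
Proof.
rewrite /norm_bound PoszD (big_morph Posz PoszD (erefl _)); congr (_ + _).
rewrite big_nat_mul big_mkord; apply: eq_bigr => i _.
rewrite -{1}[(i * n)%N]add0n big_addn mulSn addnK big_mkord.
apply: eq_bigr => j _; rewrite addnC entriesE.
by rewrite -mulnn PoszM abszE -expr2 real_normK ?num_real.
Qed.

Lemma row_sqr_le n (B : 'M[int]_n) i :
  \sum_j (B i j) ^+ 2 <= norm_bound n (entries n B).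
Proof.
rewrite norm_boundE [X in _ <= _ + X](bigD1 i) //= addrCA lerDl addr_ge0 //.
by apply: sumr_ge0 => k _; apply: sumr_ge0 => j _; apply: sqr_ge0.
Qed.

Lemma row_norm_le n (B : 'M[int]_n) i :
  \sum_j `|B i j| <= norm_bound n (entries n B).
Proof.
apply: le_trans (row_sqr_le n B i); apply: ler_sum => j _.
rewrite -[B i j ^+ 2]real_normK ?num_real //.
by move: (`|B i j|) (normr_ge0 (B i j)) => z hz; nia.
Qed.

Lemma col_sqnorm_le n (B : 'M[int]_n) j :
  sqnorm n (col j B) <= norm_bound n (entries n B).
Proof.
rewrite norm_boundE exchange_big /= [X in _ <= _ + X](bigD1 j) //= addrCA.
rewrite /sqnorm (eq_bigr (fun i => B i j ^+ 2)); last by move=> i _; rewrite mxE.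
rewrite lerDl addr_ge0 //.
by apply: sumr_ge0 => k _; apply: sumr_ge0 => l _; apply: sqr_ge0.
Qed.

(** Written on the linear index used in memory, where row 0 is [i * n + j < n]; unlike [perturbed]
    it also covers dimension 0. *)
Definition query_matrix n (b : nat -> int) : 'M[int]_n :=
  \matrix_(i < n, j < n) (b (i * n + j)%N * scale n b
     + Posz (if i * n + j < n then radix n b ^ (i * n + j) else 0)%N).

(** The interface between the lattice argument and the machine: all that decoding needs to know
    about the answer [q], the root [r] and the digits [y]. *)
Definition decodable n (b : nat -> int) (q r : nat) (y : nat -> int) :=
  [/\ (q <= 3 * (norm_bound n b * (scale n b * scale n b)))%N,
      (q %% (scale n b + scale n b) = r * r)%N, (r < code_bound n b)%N,
      forall i, (i < n)%N -> (`|y i| <= coef_bound n b)%N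
    & Posz r = digits_from n b y 0].

Lemma query_matrixE m (B : 'M[int]_m.+1) (b := entries _ B) :
  query_matrix m.+1 b = perturbed m B (radix m.+1 b) (scale m.+1 b).
Proof.
apply/matrixP => i j; rewrite !mxE {1}/b entriesE; congr (_ + _).
case: eqP => [->|hi]; first by rewrite mul0n add0n ltn_ord Posz_exp.
rewrite ifF //; apply/negbTE; rewrite -leqNgt.
case: i hi => [[|i] hi] hne; first by case: hne; apply: val_inj.
by rewrite /= mulSn -addnA leq_addr.
Qed.

Lemma decodable_pos m (B : 'M[int]_m.+1) (O : oracle) (b := entries _ B) :
  svp_oracle O -> \det B != 0 ->
  \det (query_matrix m.+1 b) != 0 /\
  exists q r y, [/\ O m.+1 (query_matrix m.+1 b) = Posz q, decodable m.+1 b q r y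
    & forall v : 'cV[int]_m.+1, (forall j : 'I_m.+1, v j 0 = partial_row m.+1 b y j m.+1) ->
      lattice (mxR B) (mxR v) /\ vnorm (mxR v) = lambda1 (mxR B)].
Proof.
move=> hO hdet; rewrite query_matrixE.
pose S : int := norm_bound m.+1 b; pose K : int := radix m.+1 b.
have hSn : m.+1%:Z < S by rewrite ltz_nat norm_bound_gt.
have hrow i : \sum_j `|B i j| <= S by apply: row_norm_le.
have hcol : sqnorm _ (col ord0 B) <= S by apply: col_sqnorm_le.
have hK : K = 4 * S ^+ m.+2 by rewrite /K /radix PoszM Posz_exp.
have hP : Posz (code_bound m.+1 b) = K ^+ m.+2 by rewrite /code_bound Posz_exp.
have hN : Posz (scale m.+1 b) = K ^+ m.+2 * K ^+ m.+2 by rewrite /scale PoszM hP.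
have hdet' := perturbed_det m B S K hdet hSn hrow hcol hK.
rewrite hN; split=> //.
have [y0 hy0] := shortest_exists m (perturbed m B K (K ^+ m.+2 * K ^+ m.+2)).
(* The answer determines the offset only up to sign. Of the two shortest vectors [y0] and [- y0],
   the one with nonnegative offset is what the program decodes. *)
have {y0 hy0}[y [hy hpos]] : exists y,
    shortest m (perturbed m B K (K ^+ m.+2 * K ^+ m.+2)) y /\ 0 <= offset m K y.
  case: (lerP 0 (offset m K y0)) => h; first by exists y0.
  by exists (- y0); split; [apply: shortestN|rewrite offsetN oppr_ge0 ltW].
have hyB := shortest_perturbed m B S K hdet hSn hrow hcol hK y hy.
pose yn i : int := y (inord i) 0.
have hq := hO _ _ hdet'.
rewrite (lambda1_shortest _ _ _ hdet' hy) vnorm_mxR sqr_sqrtr in hq; last first.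
  by rewrite ler0z sqnorm_ge0.
move: hq => /eqP; rewrite eqr_int => /eqP hq.
have q0 := sqnorm_ge0 _ (perturbed m B K (K ^+ m.+2 * K ^+ m.+2) *m y).
have hmod := sqnorm_perturbed_mod m B S K hdet hSn hrow hcol hK y hyB.
have hle := sqnorm_perturbed_le m B S K hdet hSn hrow hcol hK y hy.
move: hq q0 hmod hle; move: (sqnorm _ _) => q hq; case: q hq => // q hq _ hmod hle.
exists q, (absz (offset m K y)), yn; split=> //.
  have hlt := shortest_offset_lt m B S K hdet hSn hrow hcol hK y hyB.
  split.
  - by move: hle; rewrite -hN /S -!PoszM lez_nat.
  - apply/eqP; rewrite -eqz_nat; apply/eqP.
    have := hmod; rewrite -hN -PoszD modz_nat => ->.
    by rewrite PoszM gez0_abs // expr2.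
  - by rewrite -ltz_nat hP abszE.
  - move=> i _; rewrite -lez_nat abszE /coef_bound Posz_exp.
    exact: (shortest_entry_le m B S K hdet hSn hrow hcol hK).
  rewrite gez0_abs // /digits_from big_mkord; apply: eq_bigr => i _.
  by rewrite /yn inord_val mulrC subn0.
move=> v hv.
have -> : v = B *m y.
  apply/colP => j; rewrite hv mxE /partial_row big_mkord; apply: eq_bigr => k _.
  by rewrite {1}/b entriesE /yn inord_val.
split; first by exists y; rewrite mxR_mul.
by rewrite (lambda1_shortest _ _ _ hdet hyB).
Qed.

(** The empty matrix has determinant 1, so it is a legal input and a legal query, and the oracle
    must answer 0. *)
Lemma decodable_zero (B : 'M[int]_0) (O : oracle) (b := entries _ B) :
  svp_oracle O ->
  \det (query_matrix 0 b) != 0 /\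
  exists q r y, [/\ O 0 (query_matrix 0 b) = Posz q, decodable 0 b q r y
    & forall v : 'cV[int]_0, (forall j : 'I_0, v j 0 = partial_row 0 b y j 0) ->
      lattice (mxR B) (mxR v) /\ vnorm (mxR v) = lambda1 (mxR B)].
Proof.
move=> hO; have hdet : \det (query_matrix 0 b) != 0 by rewrite det_mx00 oner_neq0.
split=> //; exists 0%N, 0%N, (fun=> 0); split.
- have := hO _ _ hdet; rewrite lambda1_mx00 expr0n /= => /eqP.
  by rewrite intr_eq0 => /eqP.
- by split=> //; rewrite /digits_from big_geq.
move=> v _; split; last by rewrite lambda1_mx00 /vnorm big_ord0 sqrtr0.
by exists 0; apply/matrixP => -[].
Qed.

Lemma reduction_correct n (B : 'M[int]_n) (O : oracle) (b := entries _ B) :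
  svp_oracle O -> \det B != 0 ->
  \det (query_matrix n b) != 0 /\
  exists q r y, [/\ O n (query_matrix n b) = Posz q, decodable n b q r y
    & forall v : 'cV[int]_n, (forall j : 'I_n, v j 0 = partial_row n b y j n) ->
      lattice (mxR B) (mxR v) /\ vnorm (mxR v) = lambda1 (mxR B)].
Proof.
rewrite {}/b; case: n B => [|m] B hO hdet; first exact: decodable_zero.
exact: decodable_pos.
Qed.

End Reduction.

(** * The complete program and its execution *)

Section Machine.
Local Open Scope nat_scope.

Definition prepare : code :=
  seqc save_low_cells (seqc recover_size (seqc copy_input
  (seqc compute_norm_bound (seqc compute_coef_bound (seqc compute_code_bound
  (seqc scale_matrix perturb_matrix)))))).

Definition decode : code :=
  seqc extract_square (seqc square_root (seqc decode_digits copy_output)).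

(** No final [IHalt] is written: past the end, [nth] returns it by default. *)
Definition svp_program : program :=
  prepare 0 ++ [:: IOracle 0 16] ++ decode (size (prepare 0)).+1.

Variables (n : nat) (b : nat -> int).
Hypothesis hb0 : forall k, n * n <= k -> b k = 0.

(** The second factor [N] is there for the oracle's answer, up to [3 S N^2]; the triples otherwise
    ask only for [512 S N]. *)
Definition value_bound := 512 * (norm_bound n b * (scale n b * scale n b)).

Lemma scale_gt0 : 0 < scale n b.
Proof. by have [[h1 h2 h3 h4 h5] [h6 h7 h8]] := param_facts n b; lia. Qed.

Lemma value_bound_ge : 512 * (norm_bound n b * scale n b) <= value_bound.
Proof. by rewrite leq_mul2l leq_mul2l leq_pmulr ?orbT ?scale_gt0. Qed.

Definition prepare_time := 22 * (n * n) + 22 * n + 100.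
Definition decode_time := 7 * trunc_log 2 (code_bound n b) + 9 * (n * n) + 20 * n + 100.

Lemma prepare_ok :
  triple value_bound prepare_time (input_at n b) prepare (has_query n b).
Proof.
have hG := value_bound_ge; have hA := addr_le n b _ hG.
apply: triple_weaken (triple_seq (save_low_cells_ok n _ b hb0 hA)
  (triple_seq (recover_size_ok n _ b hb0 hA)
  (triple_seq (copy_input_ok n _ b hb0 hA)
  (triple_seq (compute_norm_bound_ok n b _ hG)
  (triple_seq (compute_coef_bound_ok n b _ hG)
  (triple_seq (compute_code_bound_ok n b _ hG)
  (triple_seq (scale_matrix_ok n b _ hG)
  (perturb_matrix_ok n b _ hG)))))))) => //.
by rewrite /prepare_time; lia.
Qed.

Lemma decode_ok q r y : decodable n b q r y ->
  triple value_bound decode_time (fun f => [/\ has_params n b f & f 0 = Posz q])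
    decode (fun f => forall j, j < n -> f j.+1 = partial_row n b y j n).
Proof.
move=> [hq hqr hr hy hry]; have hG := value_bound_ge.
have hqG : q <= value_bound by rewrite /value_bound; lia.
apply: triple_weaken (triple_seq (extract_square_ok n _ b hG q r y hqG hqr hr hry)
  (triple_seq (square_root_ok n _ b hG q r y hqG hqr hr hry)
  (triple_seq (decode_digits_ok n _ b hb0 hG q r y hqG hqr hr hy hry)
  (copy_output_ok n _ b hG q r y hqG hqr hr hry _)))) => //.
by rewrite /decode_time; lia.
Qed.

Lemma bounded_input f : input_at n b f -> bounded value_bound f.
Proof.
move=> hf x; rewrite hf; have hG := value_bound_ge.
have hA := addr_le n b _ hG.
case: eqP => _; first by lia.
case: (leqP (n * n) x.-1) => hx; first by rewrite hb0.
have := entry_le n b _ hx.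
have [[h1 h2 h3 h4 h5] [h6 h7 h8]] := param_facts n b.
have : norm_bound n b <= norm_bound n b * scale n b by rewrite leq_pmulr ?scale_gt0.
by lia.
Qed.

Lemma query_mxE f : has_query n b f ->
  query_mx f 16 = existT (fun m => 'M[int]_m) n (query_matrix n b).
Proof.
move=> [_ f16 fq]; have e : `|f 16| = n by rewrite f16.
rewrite /query_mx /= e; congr existT; apply/matrixP => i j.
by rewrite !mxE -fq ?row_entry_lt // -!addnA.
Qed.

Lemma svp_program_run (O : oracle) (f : ram) q r y :
  input_at n b f -> O n (query_matrix n b) = Posz q -> decodable n b q r y ->
  exists fuel st, run O svp_program fuel (State 0 f 0 [::]) = Some st
    /\ cost st <= (prepare_time + decode_time + 1) * unit_cost value_bound
    /\ queries st = [:: existT (fun m => 'M[int]_m) n (query_matrix n b)]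
    /\ forall j, j < n -> memory st j.+1 = partial_row n b y j n.
Proof.
move=> hf hO hd.
have hc1 : code_at svp_program 0 (prepare 0).
  by exists [::], ([:: IOracle 0 16] ++ decode (size (prepare 0)).+1).
have hc2 : code_at svp_program (size (prepare 0)).+1 (decode (size (prepare 0)).+1).
  exists (prepare 0 ++ [:: IOracle 0 16]), [::].
  by rewrite cats0 -catA size_cat addn1.
have hco : nth IHalt svp_program (size (prepare 0)) = IOracle 0 16.
  by rewrite nth_cat ltnn subnn.
have [f1 [w1 [r1 [l1 [b1 q1]]]]] :=
  prepare_ok O svp_program 0 f 0 [::] hc1 (bounded_input f hf) hf.
have Pq : has_params n b (upd f1 0 (Posz q)) /\ upd f1 0 (Posz q) 0 = Posz q.
  have [[B1 f8 f11 f12 f9] _ _] := q1; split=> //; split=> //.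
  by rewrite -(glueK f1) upd_glue_reg //; apply: has_base_glue B1 _ _ _ _ _.
have hqG : `|Posz q| <= value_bound.
  by have [hq _ _ _ _] := hd; rewrite /value_bound absz_nat; lia.
have r2 : reach O svp_program (State (size (prepare 0)) f1 w1 [::])
    (State (size (prepare 0)).+1 (upd f1 0 (Posz q)) w1.+1
       [:: existT (fun m => 'M[int]_m) n (query_matrix n b)]).
  have hOq : O (projT1 (query_mx f1 16)) (projT2 (query_mx f1 16)) = Posz q.
    by rewrite query_mxE.
  apply: reach_step; rewrite /step [pc _]/= hco /= query_mxE //.
  by congr (Some (State _ (upd _ _ _) _ _)); exact: hOq.
have [f2 [w2 [r3 [l3 [b3 q3]]]]] := decode_ok q r y hd O svp_program _
  (upd f1 0 (Posz q)) w1.+1 [:: existT (fun m => 'M[int]_m) n (query_matrix n b)]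
  hc2 (bounded_upd _ _ _ _ b1 hqG) Pq.
have [k hk] := reach_trans _ _ _ _ _ r1 (reach_trans _ _ _ _ _ r2 r3).
(* The additional unit of fuel pays for the halting step. *)
exists (k + 1), (State ((size (prepare 0)).+1 + size (decode (size (prepare 0)).+1))
  f2 w2 [:: existT (fun m => 'M[int]_m) n (query_matrix n b)]).
split; last split=> //=.
  have hend : nth IHalt svp_program
      ((size (prepare 0)).+1 + size (decode (size (prepare 0)).+1)) = IHalt.
    by rewrite nth_default // /svp_program !size_cat addnA addn1.
  by rewrite hk /run /step [pc _]/= hend.
have hu : 0 < unit_cost value_bound by [].
apply: (leq_trans l3); rewrite [leqRHS]mulnDl [X in _ <= X + _]mulnDl mul1n addnAC.
by rewrite leq_add2r -addn1 leq_add.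
Qed.

End Machine.

(** * Polynomial bound on the logarithmic cost *)

Section Cost.
Local Open Scope nat_scope.

Lemma entries_le n (B : 'M[int]_n) k : `|entries n B k| <= maxentry B.
Proof.
case: (leqP (n * n) k) => hk; first by rewrite entries0.
rewrite /entries /init_mem /= hk.
case: eqP => // h1; case: eqP => // h2.
rewrite /maxentry (bigD1 (Ordinal h1)) //= (bigD1 (Ordinal h2)) //=.
by rewrite -maxnA leq_maxl.
Qed.

Variables (n : nat) (B : 'M[int]_n) (z : nat).
Hypothesis hzn : n < z.
Hypothesis hzM : trunc_log 2 (maxentry B) < z.

Local Notation b := (entries n B).

Lemma norm_bound_log : norm_bound n b <= 2 ^ (5 * z).
Proof.
have z1 : 0 < z by lia.
have hn : n.+1 <= 2 ^ z.
  by apply: (@leq_trans (2 ^ n)); [exact: ltn_expl|rewrite leq_pexp2l //; lia].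
have hM : maxentry B <= 2 ^ z.
  apply: ltnW; apply: leq_trans (trunc_log_ltn _ (isT : 1 < 2)) _.
  by rewrite leq_pexp2l.
have hs : \sum_(0 <= k < n * n) `|b k| ^ 2 <= 2 ^ (4 * z).
  apply: (@leq_trans (\sum_(0 <= k < n * n) (2 ^ z) ^ 2)).
    apply: leq_sum => k _; rewrite leq_exp2r //.
    exact: leq_trans (entries_le n B k) hM.
  rewrite sum_nat_const_nat subn0 (_ : 4 * z = z + z + (z * 2)); last lia.
  by rewrite !expnD expnM; apply: leq_mul => //; apply: leq_mul; apply: ltnW.
apply: (@leq_trans (2 ^ (4 * z) * 2)).
  rewrite muln2 -addnn leq_add // (leq_trans hn) // leq_pexp2l //; lia.
by rewrite -expnSr leq_pexp2l //; lia.
Qed.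

Lemma coef_bound_log : coef_bound n b <= 2 ^ (5 * z ^ 2).
Proof.
apply: (@leq_trans ((2 ^ (5 * z)) ^ n.+1)); first by rewrite leq_exp2r // norm_bound_log.
rewrite -expnM leq_pexp2l // -mulnn mulnA leq_mul2l.
by lia.
Qed.

Lemma radix_log : radix n b <= 2 ^ (7 * z ^ 2).
Proof.
have z1 : 0 < z ^ 2 by rewrite expn_gt0; lia.
apply: (@leq_trans (2 ^ 2 * 2 ^ (5 * z ^ 2))).
  by rewrite leq_mul2l coef_bound_log.
by rewrite -expnD leq_pexp2l //; lia.
Qed.

Lemma code_bound_log : code_bound n b <= 2 ^ (7 * z ^ 3).
Proof.
apply: (@leq_trans ((2 ^ (7 * z ^ 2)) ^ n.+1)); first by rewrite leq_exp2r // radix_log.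
rewrite -expnM leq_pexp2l // (expnSr _ 2) mulnA leq_mul2l.
by lia.
Qed.

Lemma scale_log : scale n b <= 2 ^ (14 * z ^ 3).
Proof.
rewrite (_ : 14 * z ^ 3 = 7 * z ^ 3 + 7 * z ^ 3); last lia.
by rewrite expnD leq_mul // code_bound_log.
Qed.

Lemma z_pow i : 0 < i -> z <= z ^ i.
Proof.
move=> hi; rewrite -{1}(expn1 z) leq_pexp2l //; lia.
Qed.

Lemma value_bound_log : value_bound n b <= 2 ^ (42 * z ^ 3).
Proof.
have h3 := z_pow 3 isT; have z1 : 0 < z by lia.
apply: (@leq_trans (2 ^ (9 + (5 * z + (14 * z ^ 3 + 14 * z ^ 3))))); last first.
  by rewrite leq_pexp2l //; lia.
rewrite (expnD 2 9) (expnD 2 (5 * z)) (expnD 2 (14 * _)) /value_bound; apply: leq_mul => //.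
by apply: leq_mul; [exact: norm_bound_log | apply: leq_mul; exact: scale_log].
Qed.

(** Here log S is O(z), and each of the two successive powers with exponent [n.+1] costs a factor
    [z], so log P is O(z^3). The instruction count is dominated by the Heron rounds, thus O(z^3)
    like the unit cost; 350 and 106 leave room for the lower terms. *)
Lemma total_time_le :
  (prepare_time n + decode_time n b + 1) * unit_cost (value_bound n b)
    <= 350 * 106 * z ^ 6.
Proof.
have h3 := z_pow 3 isT; have z1 : 0 < z by lia.
have hz2 : z ^ 2 <= z ^ 3 by rewrite leq_pexp2l.
have hu : unit_cost (value_bound n b) <= 106 * z ^ 3.
  rewrite /unit_cost /bln.
  have : trunc_log 2 (value_bound n b) <= 42 * z ^ 3.
    rewrite -[X in _ <= X](@trunc_expnK 2) //.
    by rewrite leq_trunc_log // value_bound_log.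
  by lia.
have hl : trunc_log 2 (code_bound n b) <= 7 * z ^ 3.
  rewrite -[X in _ <= X](@trunc_expnK 2) //.
  by rewrite leq_trunc_log // code_bound_log.
have hnn : n * n <= z ^ 2 by rewrite -mulnn leq_mul //; lia.
have hn : n <= z by exact: ltnW.
have ht : prepare_time n + decode_time n b + 1 <= 350 * z ^ 3.
  by rewrite /prepare_time /decode_time; lia.
apply: leq_trans (leq_mul ht hu) _.
by rewrite mulnACA -expnD.
Qed.

End Cost.

Theorem mainTheorem6 :
  exists (P : program) (c k : nat),
  forall O : oracle, svp_oracle O ->
  forall (n : nat) (B : 'M[int]_n), \det B != 0 ->
  exists (fuel : nat) (st : state),
    run O P fuel (init_state B) = Some st
    /\ (cost st <= c * (n + trunc_log 2 (maxentry B) + trunc_log 2 n + 1) ^ k)%N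
    /\ (exists B' : 'M[int]_n,
          queries st = [:: existT (fun m => 'M[int]_m) n B'] /\ \det B' != 0)
    /\ lattice (mxR B) (mxR (output n (memory st)))
    /\ vnorm (mxR (output n (memory st))) = lambda1 (mxR B).
Proof.
exists svp_program, (350 * 106)%N, 6%N => O hO n B hdet.
have [hdet' [q [r [y [hq hd hv]]]]] := reduction_correct n B O hO hdet.
have [fuel [st [hrun [hcost [hqs hout]]]]] :=
  svp_program_run n _ (entries0 n B) O _ q r y (input_at_init n B) hq hd.
have [hlat hlen] := hv (output n (memory st))
  (fun j => etrans (mxE _ _ _ _) (hout j (ltn_ord j))).
exists fuel, st; split; first exact: hrun.
(* Unification takes for [z] the whole sum of the statement; [lia] checks that it exceeds [n] and
   the logarithm of the largest entry. *)
split; first by apply: leq_trans hcost (total_time_le n B _ _ _); lia.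
by split; first by exists (query_matrix n (entries n B)).
Qed.
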